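(* Let $d\in\mathbb{N}$, $r\in(0,\infty)$, let $\mathcal{H}$ be a weighted Hardy space in $d$ variables and radius $r$, and let $\mathcal{H}_1,\mathcal{H}_2\in[\mathcal{H}]_r$ have generating functions $G_1(t)=\sum_{n=0}^\infty a_nt^n$ and $G_2(t)=\sum_{n=0}^\infty b_nt^n$ respectively. Set $$M=\max\left\{\sup_n\frac{b_n}{a_n},\ \sup_n\frac{a_n}{b_n}\right\},\qquad m=\min\left\{\sup_n\frac{b_n}{a_n},\ \sup_n\frac{a_n}{b_n}\right\}.$$ Then $$\max\left\{\tfrac16\log M,\ \tfrac13\log m\right\}\le\rho_{\mathrm{RK}}(\mathcal{H}_1,\mathcal{H}_2)\le\tfrac12\log(Mm).$$
   Context: For $d\in\mathbb{N}$ and $r\in(0,\infty]$ let $r\mathbb{B}_d=\{z\in\mathbb{C}^d:|z|<r\}$ and $\overline{r\mathbb{B}_d}=\{z\in\mathbb{C}^d:|z|\le r\}$; $\langle\cdot,\cdot\rangle_d$ is the standard inner product on $\mathbb{C}^d$. A Hilbert function space (RKHS) on a set $X$ is a Hilbert space $\mathcal H$ of complex functions on $X$ all of whose point evaluations are bounded; $k_x\in\mathcal H$ is the vector with $f(x)=\langle f,k_x\rangle$ for all $f\in\mathcal H$. Generating function: a power series $G(t)=\sum_{n\ge0}a_nt^n$ with $a_0=1$, $a_n>0$ for all $n$, and radius of convergence in $(0,\infty]$. Weighted Hardy space in $d$ variables: a Hilbert function space of holomorphic functions on a ball centred at $0$ in $\mathbb{C}^d$, in which the monomials $z^\alpha$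 form a complete orthogonal set of nonzero vectors with $\|z^\alpha\|^2/\alpha!=\|z^\beta\|^2/\beta!$ whenever $|\alpha|=|\beta|$, and $\|\mathbf{1}\|=1$. Equivalently its reproducing kernel is $K(z,w)=G(\langle z,w\rangle_d)$ for a (unique) generating function $G=\sum a_nt^n$ (the generating function of the space), and then $\|z^\alpha\|^{-2}=a_{|\alpha|}\frac{|\alpha|!}{\alpha!}$. Convention: every weighted Hardy space is regarded as a space of functions on its natural maximal domain $X$, and its radius is the number $r$ such that $r^2\in(0,\infty]$ is the radius of convergence of $G$: $X=\mathbb{C}^d$ if $r=\infty$; $X=r\mathbb{B}_d$ if $r<\infty$ and $G(r^2)=\infty$; $X=\overline{r\mathbb{B}_d}$ if $r<\infty$ and $G(r^2)<\infty$ (functions then extend continuously to the closed ball). An RKHS isomorphism from $\mathcal{H}_1$ (on $X_1$) to $\mathcal{H}_2$ (on $X_2$) is a bijective bounded linear map $T:\mathcal{H}_1\to\mathcal{H}_2$ with $T(k^1_x)=\overline{\lambda(x)}\,k^2_{\varphi(x)}$ for all $x\in X_1$, where $\lambda:X_1\to\mathbb{C}$ is nowhere vanishing, $\varphi:X_1\to X_2$ is a bijection, and $k^i_x$ is the reproducing kernel vector of $\mathcal{H}_i$ at $x$. $[\mathcal{H}]_r$ is the class of all weighted Hardy spaces in $d$ variables and radius $r$ that are isomorphic to $\mathcal{H}$ via an RKHS isomorphism. $\delta_{\mathrm{RK}}(\mathcal{H}_1,\mathcal{H}_2)=\inf\{\|T\|\,\|T^{-1}\|: T:\mathcal{H}_1\to\mathcal{H}_2\text{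 an RKHS isomorphism}\}$ and $\rho_{\mathrm{RK}}(\mathcal{H}_1,\mathcal{H}_2)=\log\delta_{\mathrm{RK}}(\mathcal{H}_1,\mathcal{H}_2)$. *)

(* Defs.v *)
From HB Require Import structures.
From mathcomp Require Import all_boot all_order all_algebra.
From mathcomp Require Import complex.
From mathcomp Require Import all_classical all_reals all_analysis.

Set Implicit Arguments.
Unset Strict Implicit.
Unset Printing Implicit Defensive.

Import Order.TTheory GRing.Theory Num.Theory.
Import numFieldNormedType.Exports.
Local Open Scope classical_set_scope.
Local Open Scope ring_scope.
Local Open Scope complex_scope.

(* The regular module [R[i]^o] is the copy of the complex numbers that carries
   the normed-module structure. *)
Notation Cplx R := ((complex R)^o).
Notation CVec R d := 'rV[Cplx R]_d.

Section ComplexSpace.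
Variables (R : realType) (d : nat).

Definition enorm (z : CVec R d) : R :=
  Num.sqrt (\sum_(i < d) complex.Re `|z 0 i| ^+ 2).

Definition cdot (z w : CVec R d) : Cplx R :=
  \sum_(i < d) z 0 i * (w 0 i)^*.

Definition multi_index := {ffun 'I_d -> nat}.
Definition mi_deg (alpha : multi_index) : nat := \sum_(i < d) alpha i.
Definition mi_fact (alpha : multi_index) : nat := \prod_(i < d) (alpha i)`!.
Definition monomial (alpha : multi_index) (z : CVec R d) : Cplx R :=
  \prod_(i < d) z 0 i ^+ alpha i.

End ComplexSpace.

(* A Hilbert function space on [X].  Its elements form an abstract Hilbert
   space; [rk_ev] identifies each of them with a function on [X].  The values
   of [rk_ev f] outside [X] are irrelevant: nothing below depends on them. *)
Record rkhs (R : realType) (T : Type) (X : set T) := Rkhs {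
  rk_sort :> completeNormedModType R[i] ;
  rk_dot : {dot rk_sort for Num.conj} ;
  rk_normE : forall f : rk_sort, `|f| ^+ 2 = rk_dot f f ;
  rk_ev : rk_sort -> T -> Cplx R ;
  rk_ev_linear : forall (c : R[i]) (f g : rk_sort) (x : T), X x ->
    rk_ev (c *: f + g) x = c * rk_ev f x + rk_ev g x ;
  rk_ev_inj : forall f g : rk_sort,
    (forall x, X x -> rk_ev f x = rk_ev g x) -> f = g ;
  rk_ev_bounded : forall x : T, X x -> exists c : R, forall f : rk_sort,
    `|rk_ev f x| <= c%:C * `|f| }.

Section RKHSIsomorphism.
Variables (R : realType).

(* For [x] in [X] the set below is a singleton, by the Riesz theorem. *)
Definition kvec (T : Type) (X : set T) (H : rkhs R X) (x : T) : H :=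
  xget 0 [set k : H | forall f : H, rk_ev f x = rk_dot H f k].

Definition bounded_map (V W : normedModType R[i]) (T : V -> W) : Prop :=
  exists c : R, forall f : V, `|T f| <= c%:C * `|f|.

(* The norm of a normed module over [R[i]] is [R[i]]-valued, hence the [Re]. *)
Definition opnorm (V W : normedModType R[i]) (T : V -> W) : \bar R :=
  ereal_sup [set (complex.Re `|T f|)%:E | f in [set f : V | `|f| <= 1]].

Definition rkhs_iso (T1 T2 : Type) (X1 : set T1) (X2 : set T2)
    (H1 : rkhs R X1) (H2 : rkhs R X2) (T : {linear H1 -> H2}) : Prop :=
  [/\ bijective T, bounded_map T &
      exists (lambda : T1 -> Cplx R) (phi : T1 -> T2),
        [/\ forall x, X1 x -> lambda x != 0,
            set_bij X1 X2 phi &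
            forall x, X1 x ->
              T (kvec H1 x) = (lambda x)^* *: kvec H2 (phi x)]].

Definition delta_RK (T1 T2 : Type) (X1 : set T1) (X2 : set T2)
    (H1 : rkhs R X1) (H2 : rkhs R X2) : \bar R :=
  ereal_inf [set x | exists (T : {linear H1 -> H2}) (Tinv : H2 -> H1),
    [/\ rkhs_iso T, cancel T Tinv, cancel Tinv T &
        x = (opnorm T * opnorm Tinv)%E]].

Definition rho_RK (T1 T2 : Type) (X1 : set T1) (X2 : set T2)
    (H1 : rkhs R X1) (H2 : rkhs R X2) : \bar R := lne (delta_RK H1 H2).

End RKHSIsomorphism.

Section WeightedHardy.
Variables (R : realType).

Definition conv_radius (a : nat -> R) : \bar R :=
  ereal_sup [set t%:E | t in
    [set t : R | 0 <= t /\ cvgn (series (fun n => a n * t ^+ n))]].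

Definition generating_function (a : nat -> R) : Prop :=
  [/\ a 0%N = 1, forall n, 0 < a n & (0 < conv_radius a)%E].

(* The convergence test at the radius [rho] of [G] says that [G(rho)] is
   finite, since the coefficients are positive. *)
Definition natural_domain (d : nat) (a : nat -> R) : set (CVec R d) :=
  match conv_radius a with
  | +oo%E => setT
  | rho%:E =>
      if `[< cvgn (series (fun n => a n * rho ^+ n)) >]
      then [set z | enorm z <= Num.sqrt rho]
      else [set z | enorm z < Num.sqrt rho]
  | -oo%E => set0
  end.
Arguments natural_domain : clear implicits.

(* A weighted Hardy space together with its generating function
   [sum_n wh_coef n * t ^ n], on the natural domain of the latter.
   [wh_kernel] is what relates the generating function to the space; for
   [0 < d] it determines [wh_coef]. *)
Record weighted_hardy (d : nat) := WeightedHardy {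
  wh_coef : nat -> R ;
  wh_gen : generating_function wh_coef ;
  wh_space :> rkhs R (natural_domain d wh_coef) ;
  wh_holomorphic : forall (f : wh_space) (z : CVec R d),
    ((enorm z ^+ 2)%:E < conv_radius wh_coef)%E -> differentiable (rk_ev f) z ;
  wh_continuous : forall f : wh_space,
    {within natural_domain d wh_coef, continuous (rk_ev f)} ;
  wh_monomial : multi_index d -> wh_space ;
  wh_monomialE : forall alpha z, natural_domain d wh_coef z ->
    rk_ev (wh_monomial alpha) z = monomial alpha z ;
  wh_monomial_neq0 : forall alpha, wh_monomial alpha != 0 ;
  wh_orthogonal : forall alpha beta, alpha != beta ->
    rk_dot wh_space (wh_monomial alpha) (wh_monomial beta) = 0 ;
  wh_complete : forall f : wh_space,
    (forall alpha, rk_dot wh_space f (wh_monomial alpha) = 0) -> f = 0 ;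
  wh_norm_monomial : forall alpha beta, mi_deg alpha = mi_deg beta ->
    `|wh_monomial alpha| ^+ 2 / (mi_fact alpha)%:R =
    `|wh_monomial beta| ^+ 2 / (mi_fact beta)%:R ;
  wh_norm_one : `|wh_monomial [ffun=> 0%N]| = 1 ;
  wh_kernel : forall z w, natural_domain d wh_coef z ->
    natural_domain d wh_coef w ->
    series (fun n => (wh_coef n)%:C * cdot z w ^+ n : Cplx R) @ \oo
      --> (rk_ev (kvec wh_space w) z : Cplx R) }.

Definition has_radius (d : nat) (H : weighted_hardy d) (r : R) : Prop :=
  conv_radius (wh_coef H) = (r ^+ 2)%:E.

(* A predicate, because [set] cannot hold types of such a large universe. *)
Definition iso_class (d : nat) (H : weighted_hardy d) (r : R)
    (H' : weighted_hardy d) : Prop :=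
  has_radius H' r /\ exists T : {linear H' -> H}, rkhs_iso T.

End WeightedHardy.

Arguments natural_domain {R} d a.

(* Main.v *)
Require Import Defs.
From HB Require Import structures.
From mathcomp Require Import all_boot all_order all_algebra.
From mathcomp Require Import complex ring lra.
From mathcomp Require Import all_classical all_reals all_analysis.

(** Write a_n, b_n for the coefficients of the two generating functions, k_x for
the kernel vectors, and A = sup b_n / a_n, B = sup a_n / b_n, so that
M m = A B.  Since a_0 = b_0 = 1, both A and B are at least 1.

Upper bound.  When A or B is infinite there is nothing to prove.  Otherwise
both series converge or diverge together at r^2, so the two spaces live on the
same domain, and the map sending the kernel vector of the first space at x to
that of the second at x is an RKHS isomorphism.  Indeed the degree n part of
k_x is a_n <., x>^n, and its squared norm is a_n |x|^(2 n): passing from one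
space to the other multiplies all squared norms in degree n by b_n / a_n.
Hence the operator has norm at most sqrt A, its inverse has norm at most
sqrt B ([inclusion_kernel_map], [inclusion_distortion]), and
sqrt (A B) is the bound to be proved.

Lower bound.  The adjoint of an RKHS isomorphism T is the weighted composition
f |-> lam * (f \o phi).  Suppose first that phi fixes the origin.  Then the
adjoint does not lower the order of vanishing at the origin
([dot_S_lower]), so for a kernel vector k_x only the tail of degrees >= n is
seen by functions of degree n in the other space.  This gives
|lam x|^2 b_n |phi x|^(2 n) <= ||T||^2 ||tail of degree >= n of k_x||^2
([coef_tail_bound]).  Letting n grow, and using that both generating functions
have the same radius of convergence, yields |phi x| <= |x|: a Schwarz lemma
([schwarz]).  The inverse of phi satisfies it as well, whence |phi x| = |x|.
Letting now x tend to 0 with n fixed, the same inequality becomes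
|lam 0|^2 b_n <= ||T||^2 a_n ([coef_le]).  Multiplied by its analogue for the
inverse of T, it gives A B <= (||T|| ||T^-1||)^2.

In general let p = phi 0 and let q be the point with phi q = 0.  A maximum
principle on the circle of all e^(i t) q produces a point y = phi (e^(i t) q)
with |y| >= |p|; as phi q = 0, by continuity there is one with |y| = |p|
([circle_maximum], [circle_level]).  Let W be a unitary map of C^d sending p
to y.  Composition with unitary maps acts isometrically on weighted Hardy spaces, and
0 -> p -> y -> e^(i t) q -> q -> 0 under phi, W, phi^-1, a rotation, phi.
So the corresponding product of T, T^-1, T and two unitary operators
is an RKHS isomorphism fixing the origin; its distortion is at most the cube
of that of T ([recentred_kernel_iso]).  Hence A B <= (||T|| ||T^-1||)^6
([kernel_iso_coefs]), and both lower bounds follow because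
M <= A B and m^2 <= A B. *)

Set Implicit Arguments.
Unset Strict Implicit.
Unset Printing Implicit Defensive.

Import Order.TTheory GRing.Theory Num.Theory.
Import numFieldNormedType.Exports.
Local Open Scope classical_set_scope.
Local Open Scope ring_scope.

(** * Norms and convergence with real values *)

Section RealNorm.
Variables (R : realType).

(** The norm of a module over [R[i]] takes its values in [R[i]], which is only
partially ordered; its real part lives where limits and estimates can be
taken. *)
Definition rnorm (V : normedModType R[i]) (f : V) : R := complex.Re `|f|.

Local Notation "c %:C" := (real_complex R c).

Lemma rnormE (V : normedModType R[i]) (f : V) : `|f| = (rnorm f)%:C.
Proof. by rewrite /rnorm RRe_real // normr_real. Qed.

Lemma rnorm_ge0 (V : normedModType R[i]) (f : V) : 0 <= rnorm f.
Proof. by rewrite -ler0c -rnormE normr_ge0. Qed.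

Lemma rnorm0 (V : normedModType R[i]) : rnorm (0 : V) = 0.
Proof. by rewrite /rnorm normr0. Qed.

Lemma rnorm_eq0 (V : normedModType R[i]) (f : V) : rnorm f = 0 -> f = 0.
Proof. by move=> e; apply/normr0_eq0; rewrite rnormE e. Qed.

Lemma rnormD (V : normedModType R[i]) (f g : V) : rnorm (f + g) <= rnorm f + rnorm g.
Proof. by rewrite -lecR rmorphD /= -!rnormE ler_normD. Qed.

Lemma rnormN (V : normedModType R[i]) (f : V) : rnorm (- f) = rnorm f.
Proof. by rewrite /rnorm normrN. Qed.

Lemma rnormB (V : normedModType R[i]) (f g : V) : rnorm (f - g) <= rnorm f + rnorm g.
Proof. by rewrite -(rnormN g) rnormD. Qed.

Lemma rnorm_distC (V : normedModType R[i]) (f g : V) : rnorm (f - g) = rnorm (g - f).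
Proof. by rewrite -rnormN opprB. Qed.

Lemma rnormZ (V : normedModType R[i]) (c : Cplx R) (f : V) :
  rnorm (c *: f) = rnorm c * rnorm f.
Proof. by apply: (@complexI R); rewrite rmorphM /= -!rnormE normrZ. Qed.

Lemma rnormM (c e : Cplx R) : rnorm (c * e : Cplx R) = rnorm c * rnorm e.
Proof. exact: rnormZ. Qed.

Lemma rnormX (c : Cplx R) n : rnorm (c ^+ n : Cplx R) = rnorm c ^+ n.
Proof.
by apply: (@complexI R); rewrite rmorphXn /= -!rnormE; exact: normrX.
Qed.

Lemma rnorm_real (t : R) : rnorm (t%:C : Cplx R) = `|t|.
Proof. by apply: (@complexI R); rewrite -rnormE normc_def /= expr0n /= addr0 sqrtr_sqr. Qed.

Lemma rnorm_conj (c : Cplx R) : rnorm (Num.conj c : Cplx R) = rnorm c.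
Proof. by rewrite /rnorm; congr (complex.Re _); exact: normcJ. Qed.

Lemma rnorm_mulJ (c : Cplx R) : c * Num.conj c = (rnorm c ^+ 2)%:C.
Proof. by rewrite rmorphXn /= -rnormE; apply/esym; exact: (@sqr_normc R). Qed.

Lemma rnorm_sum (V : normedModType R[i]) (I : Type) (r : seq I) (P : pred I)
    (F : I -> V) : rnorm (\sum_(i <- r | P i) F i) <= \sum_(i <- r | P i) rnorm (F i).
Proof.
elim/big_ind2: _ => [|x1 x2 y1 y2 h1 h2|//]; first by rewrite rnorm0.
exact: le_trans (rnormD _ _) (lerD h1 h2).
Qed.

Lemma rnorm_dist (V : normedModType R[i]) (f g : V) : `|rnorm f - rnorm g| <= rnorm (f - g).
Proof.
have := rnormD (f - g) g; rewrite subrK => h1.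
have := rnormD (g - f) f; rewrite subrK (rnorm_distC g f) => h2.
by rewrite ler_norml; apply/andP; split; lra.
Qed.

(** Convergence is expressed through a sequence of reals, so that every passage to
the limit below is one in the ordered field [R]. *)
Definition norm_cvg (V : normedModType R[i]) (u : nat -> V) (l : V) : Prop :=
  (fun n => rnorm (u n - l)) @ \oo --> (0 : R).

End RealNorm.

(** * Inner product spaces *)

Section HilbertSpace.
Variables (R : realType) (V : completeNormedModType R[i]).
Variable dot : {dot V for Num.conj}.
Hypothesis dotE : forall f : V, `|f| ^+ 2 = dot f f.

Local Notation "c %:C" := (real_complex R c).
Local Notation conj := Num.conj.

Lemma dotff (u : V) : dot u u = (rnorm u ^+ 2)%:C.
Proof. by rewrite -dotE rnormE rmorphXn. Qed.

Lemma dotC (u v : V) : dot v u = conj (dot u v).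
Proof. by rewrite (hermC dot) expr0 mul1r. Qed.

Lemma dotDl (u v w : V) : dot (u + v) w = dot u w + dot v w.
Proof. exact: (linearDl dot). Qed.
Lemma dotDr (u v w : V) : dot w (u + v) = dot w u + dot w v.
Proof. exact: (linearDr dot). Qed.
Lemma dotBl (u v w : V) : dot (u - v) w = dot u w - dot v w.
Proof. exact: (linearBl dot). Qed.
Lemma dotBr (u v w : V) : dot w (u - v) = dot w u - dot w v.
Proof. exact: (linearBr dot). Qed.
Lemma dotZl (c : R[i]) (u w : V) : dot (c *: u) w = c * dot u w.
Proof. exact: (linearZl_LR dot). Qed.
Lemma dotZr (c : R[i]) (u w : V) : dot w (c *: u) = conj c * dot w u.
Proof. exact: (linearZr_LR dot). Qed.
Lemma dot0l (w : V) : dot 0 w = 0.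
Proof. exact: (linear0l dot). Qed.
Lemma dot0r (w : V) : dot w 0 = 0.
Proof. exact: (linear0r dot). Qed.
Lemma dot_suml (I : Type) (r : seq I) (P : pred I) (F : I -> V) w :
  dot (\sum_(i <- r | P i) F i) w = \sum_(i <- r | P i) dot (F i) w.
Proof. exact: (linear_sumlz dot). Qed.
Lemma dot_sumr (I : Type) (r : seq I) (P : pred I) (F : I -> V) w :
  dot w (\sum_(i <- r | P i) F i) = \sum_(i <- r | P i) dot w (F i).
Proof. exact: (linear_sumr dot). Qed.

Lemma rnorm_sqrD (u v : V) :
  rnorm (u + v) ^+ 2 = rnorm u ^+ 2 + rnorm v ^+ 2 + 2 * complex.Re (dot u v).
Proof.
apply: (@complexI R); rewrite -dotff dotDl !dotDr !dotff (dotC u v).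
have E (z : R[i]) : (2 * complex.Re z)%:C = z + conj z.
  case: z => a b; apply/eqP; rewrite eq_complex /= subrr.
  by apply/andP; split; apply/eqP => //; ring.
rewrite !rmorphD /=. rewrite E. by ring.
Qed.

Lemma pythagoras (u v : V) : dot u v = 0 ->
  rnorm (u + v) ^+ 2 = rnorm u ^+ 2 + rnorm v ^+ 2.
Proof. by move=> h; rewrite rnorm_sqrD h /= mulr0 addr0. Qed.

Lemma rnorm_sqrZ (c : Cplx R) (u : V) : rnorm (c *: u) ^+ 2 = rnorm c ^+ 2 * rnorm u ^+ 2.
Proof. by rewrite rnormZ exprMn. Qed.

Lemma rnorm_sqrB (u v : V) :
  rnorm (u - v) ^+ 2 = rnorm u ^+ 2 + rnorm v ^+ 2 - 2 * complex.Re (dot u v).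
Proof.
have E (z : R[i]) : complex.Re (- z) = - complex.Re z by case: z.
by rewrite rnorm_sqrD rnormN (linearNr dot) E mulrN.
Qed.

(** Positivity of the squared norm of [|v|^2 u - <u, v> v], which is the projection
of [u] orthogonally to [v], scaled to avoid a division. *)
Lemma cauchy_schwarz (u v : V) : rnorm (dot u v : Cplx R) <= rnorm u * rnorm v.
Proof.
have [->|v0] := eqVneq v 0; first by rewrite dot0r rnorm0 rnorm0 mulr0.
have nv : 0 < rnorm v.
  by rewrite lt_neqAle rnorm_ge0 andbT eq_sym; apply: contra_neq v0 => /rnorm_eq0.
pose a := dot u v.
have : 0 <= rnorm ((rnorm v ^+ 2)%:C *: u - a *: v) ^+ 2 by rewrite exprn_ge0 ?rnorm_ge0.
rewrite rnorm_sqrB !rnorm_sqrZ rnorm_real.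
rewrite dotZl dotZr -/a [conj a * a]mulrC (rnorm_mulJ a) -rmorphM /= ger0_norm ?sqr_ge0//.
rewrite [X in 0 <= X](_ : _ = rnorm v ^+ 2 * ((rnorm u * rnorm v) ^+ 2 - rnorm (a : Cplx R) ^+ 2)); last by ring.
rewrite pmulr_rge0 ?exprn_gt0// subr_ge0 => h.
by rewrite -(@ler_pXn2r _ 2) // ?nnegrE ?mulr_ge0 ?rnorm_ge0.
Qed.

Lemma complex_ltE (e : R[i]) : 0 < e -> e = (complex.Re e)%:C /\ 0 < complex.Re e.
Proof.
move=> e0; have er : e \is Num.real by rewrite gtr0_real.
by have E := RRe_real er; split; rewrite ?E// -ltcR E.
Qed.

(** Balls of the module have radii in [R[i]]; a positive radius is real, which is
what makes real Cauchy estimates sufficient. *)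
Lemma rnorm_complete (u : nat -> V) :
  (forall e : R, 0 < e -> exists N, forall m n,
     (N <= m)%N -> (N <= n)%N -> rnorm (u m - u n) <= e) ->
  exists l, norm_cvg u l.
Proof.
move=> h; have cu : cvgn u.
  apply/cauchy_cvgP/cauchy_ballP => e /complex_ltE[eE e0].
  have [N hN] := h (complex.Re e / 2) (divr_gt0 e0 (ltr0Sn _ 1)).
  exists (u @` [set n | (N <= n)%N], u @` [set n | (N <= n)%N]) => /=.
    by split; exists N => // n Nn; exists n.
  move=> [x y] /= [[m Nm <-] [n Nn <-]].
  rewrite -ball_normE /= rnormE eE ltcR.
  by apply: le_lt_trans (hN _ _ Nm Nn) _; lra.
exists (limn u); rewrite /norm_cvg; apply/cvgrPdist_le => e e0.
have /cvgrPdist_le /(_ (e%:C)) := cu; rewrite ltcR => /(_ e0).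
apply: filterS => n; rewrite rnormE lecR sub0r normrN ger0_norm ?rnorm_ge0//.
by rewrite rnorm_distC.
Qed.

End HilbertSpace.

(** * Limits in norm *)

Section Convergence.
Variables (R : realType).

Lemma norm_cvg_squeeze (V : normedModType R[i]) (u : nat -> V) (l : V) (v : nat -> R) :
  (forall n, rnorm (u n - l) <= v n) -> v @ \oo --> (0 : R) -> norm_cvg u l.
Proof.
move=> h v0; apply: (@squeeze_cvgr _ _ _ _ (fun=> 0) v) => //.
  by apply: nearW => n; rewrite rnorm_ge0 h.
exact: cvg_cst.
Qed.

Lemma norm_cvg_lip (V W : normedModType R[i]) (C : R) (u : nat -> V) (l : V)
    (v : nat -> W) (m : W) :
  (forall n, rnorm (v n - m) <= C * rnorm (u n - l)) -> norm_cvg u l -> norm_cvg v m.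
Proof.
move=> h ul; apply: (norm_cvg_squeeze h); rewrite -[X in _ --> X](mulr0 C).
by apply: cvgM ul; exact: cvg_cst.
Qed.

Lemma norm_cvg_rnorm (V : normedModType R[i]) (u : nat -> V) (l : V) :
  norm_cvg u l -> (fun n => rnorm (u n)) @ \oo --> rnorm l.
Proof.
move=> ul; apply/cvgrPdist_le => e e0.
have /cvgrPdist_le/(_ e e0) := ul; apply: filterS => n.
rewrite sub0r normrN ger0_norm ?rnorm_ge0// distrC; apply: le_trans.
exact: rnorm_dist.
Qed.

Lemma norm_cvg_near (V : normedModType R[i]) (u : nat -> V) (l : V) (e : R) :
  norm_cvg u l -> 0 < e -> exists N, forall n, (N <= n)%N -> rnorm (u n - l) <= e.
Proof.
move=> /cvgrPdist_le h /h [N _ hN]; exists N => n /hN /=.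
by rewrite sub0r normrN ger0_norm ?rnorm_ge0.
Qed.

(** Closed balls are closed. *)
Lemma norm_cvg_bound (V : normedModType R[i]) (u : nat -> V) (l m : V) (B : R) :
  norm_cvg u l -> (exists N, forall n, (N <= n)%N -> rnorm (u n - m) <= B) ->
  rnorm (l - m) <= B.
Proof.
move=> ul [N h]; apply/ler_addgt0Pr => e e0.
have [N' hN'] := norm_cvg_near ul e0.
have := h (maxn N N') (leq_maxl _ _); have := hN' (maxn N N') (leq_maxr _ _).
have := rnormD (l - u (maxn N N')) (u (maxn N N') - m).
by rewrite (rnorm_distC l) addrA subrK; lra.
Qed.

Lemma norm_cvg_unique (V : normedModType R[i]) (u : nat -> V) (l m : V) :
  norm_cvg u l -> norm_cvg u m -> l = m.
Proof.
move=> ul um; apply/eqP; rewrite -subr_eq0; apply/eqP/rnorm_eq0/eqP.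
rewrite eq_le rnorm_ge0 andbT; apply/ler_addgt0Pr => e e0; rewrite add0r.
by apply: (norm_cvg_bound ul); exact: norm_cvg_near um e0.
Qed.

Lemma norm_cvg_cst (V : normedModType R[i]) (l : V) : norm_cvg (fun=> l) l.
Proof. by rewrite /norm_cvg subrr rnorm0; exact: cvg_cst. Qed.

Lemma norm_cvg_linear (V : normedModType R[i]) (c : Cplx R) (u v : nat -> V) (l m : V) :
  norm_cvg u l -> norm_cvg v m -> norm_cvg (fun n => c *: u n + v n) (c *: l + m).
Proof.
move=> ul vm; apply: (@norm_cvg_squeeze _ _ _ (fun n => rnorm c * rnorm (u n - l) + rnorm (v n - m))).
  move=> n; rewrite opprD addrACA -scalerBr.
  by apply: le_trans (rnormD _ _) _; rewrite rnormZ.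
rewrite -[X in _ --> X](addr0 0) -[X in _ --> X + _](mulr0 (rnorm c)).
by apply: cvgD => //; apply: cvgM ul; exact: cvg_cst.
Qed.

Lemma cvg_norm_cvg (V : normedModType R[i]) (u : nat -> V) (l : V) : u @ \oo --> l -> norm_cvg u l.
Proof.
move=> /cvgrPdist_le h; apply/cvgrPdist_le => e e0.
have /h : 0 < (e%:C)%C :> R[i] by rewrite ltcR.
apply: filterS => n; rewrite rnormE lecR sub0r normrN ger0_norm ?rnorm_ge0//.
by rewrite rnorm_distC.
Qed.

Lemma norm_cvg_sum (V : normedModType R[i]) (I : Type) (s : seq I) (c : I -> Cplx R)
    (u : I -> nat -> V) (l : I -> V) :
  (forall i, norm_cvg (u i) (l i)) ->
  norm_cvg (fun n => \sum_(i <- s) c i *: u i n) (\sum_(i <- s) c i *: l i).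
Proof.
move=> ul; elim: s => [|i s IH].
  rewrite big_nil; have := norm_cvg_cst (0 : V); congr norm_cvg.
  by apply/funext => n; rewrite big_nil.
have := norm_cvg_linear (c i) (ul i) IH; rewrite big_cons; congr norm_cvg.
by apply/funext => n; rewrite big_cons.
Qed.

End Convergence.

(** * Orthogonal series *)

Section OrthogonalSeries.
Variables (R : realType) (V : completeNormedModType R[i]).
Variable dot : {dot V for Num.conj}.
Hypothesis dotE : forall f : V, `|f| ^+ 2 = dot f f.

Lemma norm_cvg_dotl (u : nat -> V) (l g : V) :
  norm_cvg u l -> norm_cvg (fun n => dot (u n) g : Cplx R) (dot l g).
Proof.
apply: (@norm_cvg_lip _ _ _ (rnorm g)) => n; rewrite -dotBl mulrC.
exact: cauchy_schwarz.
Qed.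

Lemma norm_cvg_dotr (u : nat -> V) (l g : V) :
  norm_cvg u l -> norm_cvg (fun n => dot g (u n) : Cplx R) (dot g l).
Proof.
by apply: (@norm_cvg_lip _ _ _ (rnorm g)) => n; rewrite -dotBr; exact: cauchy_schwarz.
Qed.

Lemma orthogonal_sum (e : nat -> V) (m n : nat) :
  (forall k l, k != l -> dot (e k) (e l) = 0) ->
  rnorm (\sum_(m <= k < n) e k) ^+ 2 = \sum_(m <= k < n) rnorm (e k) ^+ 2.
Proof.
move=> orth; have [n_le_m|mn] := leqP n m; first by rewrite !big_geq// rnorm0 expr0n.
elim: n mn => // n IH; rewrite ltnS leq_eqVlt => /orP[/eqP->|mn].
  by rewrite !big_nat1.
rewrite [in LHS]big_nat_recr; last exact: ltnW.
rewrite [RHS]big_nat_recr; last exact: ltnW.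
rewrite (pythagoras dotE); first by rewrite (IH mn).
rewrite dot_suml big_nat big1// => k /andP[_ kn].
by rewrite orth // ltn_eqF.
Qed.

(** Multipliers bounded by [M] act on an orthogonal family with norm at most [M].
Dilations and rotations of kernel vectors are multipliers of this kind. *)
Lemma orthogonal_sumC (e : nat -> V) (c : nat -> Cplx R) (m n : nat) (M : R) :
  (forall k l, k != l -> dot (e k) (e l) = 0) ->
  (forall k, (m <= k)%N -> rnorm (c k) <= M) ->
  rnorm (\sum_(m <= k < n) c k *: e k) <= M * rnorm (\sum_(m <= k < n) e k).
Proof.
move=> orth cM.
have M0 : 0 <= M by apply: le_trans (cM m _); rewrite ?rnorm_ge0.
rewrite -(@ler_pXn2r _ 2) // ?nnegrE ?mulr_ge0 ?rnorm_ge0// exprMn.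
rewrite !orthogonal_sum//; last first.
  by move=> k l kl; rewrite dotZl dotZr orth// !mulr0.
rewrite mulr_sumr [leRHS]big_nat_cond [leLHS]big_nat_cond.
apply: ler_sum => k /andP[/andP[mk _] _].
rewrite rnorm_sqrZ; apply: ler_pM; rewrite ?sqr_ge0//.
by rewrite lerXn2r// ?nnegrE ?rnorm_ge0// cM.
Qed.

(** By Pythagoras the squared norms of the partial sums form a nondecreasing
bounded sequence of reals, and a Cauchy estimate for it is one for the series. *)
Lemma orthogonal_series_cvg (e : nat -> V) (B : R) :
  (forall k l, k != l -> dot (e k) (e l) = 0) ->
  (forall n, rnorm (\sum_(0 <= k < n) e k) <= B) ->
  exists l, norm_cvg (fun n => \sum_(0 <= k < n) e k) l.
Proof.
move=> orth bd; apply: (@rnorm_complete _ V) => eps eps0.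
pose s n := \sum_(0 <= k < n) rnorm (e k) ^+ 2.
have s_nd : {homo s : m n / (m <= n)%N >-> m <= n}.
  move=> m n mn; rewrite /s (big_cat_nat (n := m) (p := n)) //= lerDl.
  by rewrite sumr_ge0// => i _; rewrite sqr_ge0.
have sB n : s n <= B ^+ 2.
  by rewrite /s -(orthogonal_sum 0 n orth) lerXn2r// nnegrE ?rnorm_ge0// (le_trans _ (bd 0%N)) ?rnorm_ge0.
have : cvgn s.
  apply: nondecreasing_is_cvgn => //.
  by exists (B ^+ 2) => _ [n _ <-]; exact: sB.
move=> /cauchy_cvgP/cauchy_ballP/(_ (eps ^+ 2) (exprn_gt0 _ eps0))[] [P Q] /=.
move=> [[N1 _ h1] [N2 _ h2]] h12.
exists (maxn N1 N2).
have main m n : (maxn N1 N2 <= m)%N -> (m <= n)%N ->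
    rnorm (\sum_(0 <= k < n) e k - \sum_(0 <= k < m) e k) <= eps.
  move=> Nm mn.
  rewrite (big_cat_nat (n := m) (p := n)) //= addrAC subrr add0r.
  rewrite -(@ler_pXn2r _ 2) // ?nnegrE ?rnorm_ge0 ?(ltW eps0)// orthogonal_sum//.
  have := h12 (s m, s n) (conj (h1 m (leq_trans (leq_maxl _ _) Nm))
    (h2 n (leq_trans (leq_trans (leq_maxr _ _) Nm) mn))).
  rewrite -ball_normE /= distrC ger0_norm ?subr_ge0 ?s_nd//.
  rewrite {1}/s (big_cat_nat (n := m) (p := n)) //= -/(s m) addrAC subrr add0r.
  exact: ltW.
move=> m n Nm Nn; have [mn|/ltnW n_le_m] := leqP m n.
  by rewrite rnorm_distC main.
by rewrite main.
Qed.

End OrthogonalSeries.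

Section OrthogonalTail.
Variables (R : realType) (V : completeNormedModType R[i]).
Variable dot : {dot V for Num.conj}.
Hypothesis dotE : forall f : V, `|f| ^+ 2 = dot f f.
Variables (e : nat -> V) (l : V).
Hypothesis orth : forall k j, k != j -> dot (e k) (e j) = 0.
Hypothesis el : norm_cvg (fun n => \sum_(0 <= k < n) e k) l.

Lemma rnorm_partial_sum n : rnorm (\sum_(0 <= k < n) e k) <= rnorm l.
Proof.
have h := norm_cvg_rnorm el; apply/ler_addgt0Pr => eps eps0.
have [N hN] := norm_cvg_near el eps0.
have := hN (maxn N n) (leq_maxl _ _); set m := maxn N n => hm.
have n_le_m : (n <= m)%N by exact: leq_maxr.
have le_m : rnorm (\sum_(0 <= k < n) e k) <= rnorm (\sum_(0 <= k < m) e k).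
  rewrite -(@ler_pXn2r _ 2) // ?nnegrE ?rnorm_ge0// !(orthogonal_sum dotE)//.
  rewrite (big_cat_nat (n := n) (p := m)) //= lerDl.
  by rewrite sumr_ge0// => i _; rewrite sqr_ge0.
have := rnormD (\sum_(0 <= k < m) e k - l) l; rewrite subrK; lra.
Qed.

(** The bound for finite sums survives in the limit; it is stated for the tails
because both series are known only through their sums. *)
Lemma rnorm_multiplier_tail (c : nat -> Cplx R) (m : V) (n : nat) (M : R) :
  norm_cvg (fun n => \sum_(0 <= k < n) c k *: e k) m ->
  (forall k, (n <= k)%N -> rnorm (c k) <= M) ->
  rnorm (m - \sum_(0 <= k < n) c k *: e k) <=
    M * rnorm (l - \sum_(0 <= k < n) e k).
Proof.
move=> cm cM; have M0 : 0 <= M by apply: le_trans (cM n _); rewrite ?rnorm_ge0.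
apply/ler_addgt0Pr => eps eps0.
have e1 : 0 < eps / (1 + M) by rewrite divr_gt0// ltr_pwDl.
have [N1 h1] := norm_cvg_near el e1.
have [N2 h2] := norm_cvg_near cm e1.
pose N := maxn (maxn N1 N2) n.
have nN : (n <= N)%N by exact: leq_maxr.
have {h1} := h1 N (leq_trans (leq_maxl _ _) (leq_maxl _ _)).
have {h2} := h2 N (leq_trans (leq_maxr _ _) (leq_maxl _ _)).
have split_at (F : nat -> V) :
    \sum_(0 <= k < N) F k = \sum_(0 <= k < n) F k + \sum_(n <= k < N) F k.
  exact: big_cat_nat.
rewrite (split_at e) (split_at (fun k => c k *: e k)).
have := orthogonal_sumC dotE N orth cM.
set A := \sum_(0 <= k < n) e k; set B := \sum_(n <= k < N) e k.
set A' := \sum_(0 <= k < n) _; set B' := \sum_(n <= k < N) _.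
move=> hB h2 h1.
have {h2} : rnorm (m - A') <= rnorm B' + eps / (1 + M).
  by have := rnormD (m - A' - B') B'; rewrite subrK -addrA -opprD (rnorm_distC m (A' + B')); lra.
have {h1} : rnorm B <= rnorm (l - A) + eps / (1 + M).
  by have := rnormD (A + B - l) (l - A); rewrite addrA subrK addrAC subrr add0r; lra.
move=> /(ler_wpM2l M0) h3 h4.
apply: le_trans h4 _; apply: le_trans (lerD hB (lexx _)) _.
apply: le_trans (lerD h3 (lexx _)) _.
rewrite mulrDr -addrA lerD2l -[X in _ + X]mul1r -mulrDl (addrC M) mulrC divfK ?gt_eqF ?ltr_pwDl//.
Qed.

End OrthogonalTail.

(** * Dense subspaces and extension of bounded operators *)

Section Density.
Variables (R : realType) (V : completeNormedModType R[i]).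
Variable dot : {dot V for Num.conj}.
Hypothesis dotE : forall f : V, `|f| ^+ 2 = dot f f.
Variable D : V -> Prop.
Hypothesis D0 : D 0.
Hypothesis Dlin : forall (c : R[i]) f g, D f -> D g -> D (c *: f + g).
Hypothesis total : forall f, (forall g, D g -> dot f g = 0) -> f = 0.

Lemma parallelogram (u v : V) :
  rnorm (u + v) ^+ 2 + rnorm (u - v) ^+ 2 = 2 * (rnorm u ^+ 2 + rnorm v ^+ 2).
Proof. by rewrite (rnorm_sqrD dotE) (rnorm_sqrB dotE); ring. Qed.

(** Take a sequence in [D] minimizing the distance to [f].  It is Cauchy by the
parallelogram identity, and the difference of [f] and its limit is orthogonal
to [D] by a first-order variation, so it vanishes by totality. *)
Lemma dense_of_total (f : V) (eps : R) : 0 < eps ->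
  exists2 g, D g & rnorm (f - g) <= eps.
Proof.
move=> eps0; pose S := [set rnorm (f - g) | g in D]; pose delta := inf S.
have S0 : S !=set0 by exists (rnorm (f - 0)), 0.
have hS : has_inf S by split=> //; exists 0 => _ [g _ <-]; rewrite rnorm_ge0.
have delta_le g : D g -> delta <= rnorm (f - g).
  by move=> Dg; apply: ge_inf; [exact: (proj2 hS) | exists g].
have delta0 : 0 <= delta.
  by apply: lb_le_inf S0 _ => _ [g _ <-]; rewrite rnorm_ge0.
have approx n : exists g, D g /\ rnorm (f - g) < delta + n.+1%:R^-1.
  have n0 : 0 < n.+1%:R^-1 :> R by rewrite invr_gt0.
  by have [_ [g Dg <-] h] := inf_adherent n0 hS; exists g.
have [g hg] := choice approx.
have gap m n (eta : R) : 0 <= eta -> rnorm (f - g m) <= delta + eta ->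
    rnorm (f - g n) <= delta + eta ->
    rnorm (g m - g n) ^+ 2 <= 4 * eta * (2 * delta + eta).
  move=> eta0 hm hn.
  have := parallelogram (f - g n) (f - g m).
  have -> : f - g n - (f - g m) = g m - g n.
    by rewrite opprB addrC addrA subrK.
  pose c : R[i] := 2^-1.
  (* The midpoint of [g m] and [g n] lies in [D], so it is no closer to [f] than [delta]. *)
  have -> : f - g n + (f - g m) = (2 : R[i]) *: (f - (c *: g m + (c *: g n + 0))).
    rewrite addr0 -scalerDr scalerBr scalerA divff ?pnatr_eq0// scale1r.
    by rewrite scaler_nat mulr2n opprD addrACA (addrC (- g n)).
  have n2 : rnorm (2 : Cplx R) = 2.
    by rewrite -[2 in LHS](rmorph_nat (real_complex R)) rnorm_real ger0_norm.
  rewrite rnorm_sqrZ n2.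
  have := delta_le _ (Dlin c (proj1 (hg m)) (Dlin c (proj1 (hg n)) D0)).
  set d' := rnorm (f - _) => hd.
  have hd2 : delta ^+ 2 <= d' ^+ 2 by rewrite lerXn2r// nnegrE// (le_trans delta0).
  have h1 : rnorm (f - g n) ^+ 2 <= (delta + eta) ^+ 2.
    by rewrite lerXn2r// nnegrE ?rnorm_ge0// addr_ge0.
  have h2 : rnorm (f - g m) ^+ 2 <= (delta + eta) ^+ 2.
    by rewrite lerXn2r// nnegrE ?rnorm_ge0// addr_ge0.
  nra.
have inv_small (e : R) : 0 < e -> exists N, forall n, (N <= n)%N -> n.+1%:R^-1 <= e.
  move=> e0; have [N _ hN] := near_infty_natSinv_lt (PosNum e0).
  by exists N => n /hN /ltW.
have [l gl] : exists l, norm_cvg g l.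
  apply: (@rnorm_complete _ V) => e e0.
  pose eta := Num.min 1 (e ^+ 2 / (4 * (2 * delta + 1))).
  have den0 : 0 < 4 * (2 * delta + 1) by rewrite mulr_gt0// ltr_wpDl// mulr_ge0.
  have eta0 : 0 < eta by rewrite lt_min ltr01 divr_gt0// exprn_gt0.
  have eta1 : eta <= 1 by rewrite ge_min lexx.
  have etae : eta * (4 * (2 * delta + 1)) <= e ^+ 2.
    by rewrite -ler_pdivlMr// ge_min lexx orbT.
  have [N hN] := inv_small _ eta0.
  exists N => m n Nm Nn.
  have le_eta k : (N <= k)%N -> rnorm (f - g k) <= delta + eta.
    by move=> /hN h; apply: le_trans (ltW (proj2 (hg k))) _; rewrite lerD2l.
  have := gap m n eta (ltW eta0) (le_eta _ Nm) (le_eta _ Nn).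
  move=> h; rewrite -(@ler_pXn2r _ 2) // ?nnegrE ?rnorm_ge0 ?(ltW e0)//.
  apply: le_trans h _; apply: le_trans _ etae; nra.
have dist_l : rnorm (f - l) <= delta.
  apply/ler_addgt0Pr => e e0.
  have e2 : 0 < e / 2 by rewrite divr_gt0.
  have [N1 h1] := norm_cvg_near gl e2; have [N2 h2] := inv_small _ e2.
  have {h1} := h1 (maxn N1 N2) (leq_maxl _ _).
  have {h2} := h2 (maxn N1 N2) (leq_maxr _ _).
  have := proj2 (hg (maxn N1 N2)).
  have := rnormD (f - g (maxn N1 N2)) (g (maxn N1 N2) - l); rewrite addrA subrK.
  by move: (_^-1 : R) => i; lra.
have dist_ge h : D h -> delta <= rnorm (f - l - h).
  move=> Dh; apply/ler_addgt0Pr => e e0.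
  have [N /(_ N (leqnn _)) h1] := norm_cvg_near gl e0.
  have := delta_le _ (Dlin 1 (proj1 (hg N)) Dh); rewrite scale1r.
  have := rnormD (f - l - h) (l - g N); rewrite (rnorm_distC l) opprD.
  rewrite (_ : f - l - h + (l - g N) = f + (- g N - h)); last first.
    by rewrite addrACA subrK (addrC (- h)).
  lra.
have fl : f - l = 0.
  apply: total => h Dh; pose d : Cplx R := dot (f - l) h.
  apply: (@rnorm_eq0 _ (Cplx R)); rewrite -/d; apply/eqP; rewrite eq_le rnorm_ge0 andbT leNgt.
  apply/negP => d0.
  (* A step this short makes the quadratic term of the variation at most half of the
     linear one. *)
  pose s := (1 + rnorm h ^+ 2)^-1.
  have s0 : 0 < s by rewrite invr_gt0 ltr_pwDl// sqr_ge0.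
  have s1 : s * rnorm h ^+ 2 <= 1.
    by rewrite mulrC ler_pdivrMr ?mul1r ?lerDr// ltr_pwDl// sqr_ge0.
  have := dist_ge _ (Dlin (s%:C%C * d) Dh D0); rewrite addr0 => hd.
  have : delta ^+ 2 <= rnorm (f - l - (s%:C%C * d) *: h) ^+ 2.
    by rewrite lerXn2r// nnegrE ?rnorm_ge0.
  rewrite (rnorm_sqrB dotE) dotZr -/d rnorm_sqrZ (rnormM s%:C%C d) rnorm_real (gtr0_norm s0).
  rewrite rmorphM -mulrA (mulrC (Num.conj d)) (rnorm_mulJ d).
  have ReE (x y : R) : complex.Re (Num.conj (x%:C)%C * (y%:C)%C) = x * y.
    by rewrite (conjc_real x : Num.conj (x%:C)%C = (x%:C)%C) -rmorphM.
  rewrite ReE.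
  have : rnorm (f - l) ^+ 2 <= delta ^+ 2 by rewrite lerXn2r// nnegrE ?rnorm_ge0.
  have : 0 < rnorm d ^+ 2 by rewrite exprn_gt0.
  rewrite exprMn.
  move: (rnorm d ^+ 2) (rnorm (f - l) ^+ 2) (rnorm h ^+ 2) s1 => x y z sz x0 yd dd.
  have sx : 0 < s * x by rewrite mulr_gt0.
  have : s * x * (s * z) <= s * x by rewrite ler_piMr// ltW.
  lra.
(* Now [f] is the limit of the minimizing sequence. *)
have [N /(_ N (leqnn _)) hN] := norm_cvg_near gl eps0.
exists (g N); first exact: proj1 (hg N).
by move/eqP: fl; rewrite subr_eq0 => /eqP ->; rewrite rnorm_distC.
Qed.

End Density.

Section BoundedExtension.
Variables (R : realType) (V W : completeNormedModType R[i]).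
Variable dot : {dot V for Num.conj}.
Hypothesis dotE : forall f : V, `|f| ^+ 2 = dot f f.
Variables (G : V -> W -> Prop) (C : R).
Hypothesis C0 : 0 <= C.
Hypothesis G0 : G 0 0.
Hypothesis Glin : forall (c : R[i]) f g f' g', G f f' -> G g g' ->
  G (c *: f + g) (c *: f' + g').
Hypothesis Gbound : forall f f', G f f' -> rnorm f' <= C * rnorm f.
Hypothesis Gtotal : forall f, (forall g g', G g g' -> dot f g = 0) -> f = 0.

(** [G] is the graph of a bounded operator with dense domain, given as a relation
so that its values on a spanning family need not be checked to be well defined:
the bound already forces this.  The operator is the closure of [G]. *)
Lemma bounded_extension : exists T : {linear V -> W},
  (forall f f', G f f' -> T f = f') /\ forall f, rnorm (T f) <= C * rnorm f.
Proof.
have GB f g f' g' : G f f' -> G g g' -> G (f - g) (f' - g').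
  move=> h1 h2; have := Glin (-1) h2 h1.
  by rewrite !scaleN1r ![- _ + _]addrC.
have dense f (e : R) : 0 < e -> exists2 g, (exists g', G g g') & rnorm (f - g) <= e.
  move=> e0; apply: (dense_of_total dotE) e0; first by exists 0.
    by move=> c g h [g' Gg] [h' Gh]; exists (c *: g' + h'); exact: Glin.
  by move=> {}f h; apply: Gtotal => g g' Gg; apply: h; exists g'.
have inv_small (e : R) : 0 < e -> exists N, forall n, (N <= n)%N -> n.+1%:R^-1 <= e.
  move=> e0; have [N _ hN] := near_infty_natSinv_lt (PosNum e0).
  by exists N => n /hN /ltW.
pose Gbar (f : V) (f' : W) := exists (u : nat -> V) (u' : nat -> W),
  [/\ forall n, G (u n) (u' n), norm_cvg u f & norm_cvg u' f'].
have Gbar_ex f : exists f', Gbar f f'.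
  have approx n : exists g, (exists g', G g g') /\ rnorm (f - g) <= n.+1%:R^-1.
    have n0 : 0 < n.+1%:R^-1 :> R by rewrite invr_gt0.
    by have [g Gg h] := dense f _ n0; exists g.
  have [u hu] := choice approx.
  have [u' hu'] := choice (fun n => proj1 (hu n)).
  have uf : norm_cvg u f.
    apply: (@norm_cvg_squeeze _ _ _ _ (fun n => n.+1%:R^-1)).
      by move=> n; rewrite rnorm_distC; exact: (proj2 (hu n)).
    apply/cvgrPdist_le => e /inv_small[N hN]; exists N => // n /= /hN.
    by rewrite sub0r normrN ger0_norm ?invr_ge0.
  have [l ul] : exists l, norm_cvg u' l.
    apply: (@rnorm_complete _ W) => e e0.
    pose C' := C + 1.
    have C'0 : 0 < C' by rewrite ltr_wpDl.
    have e1 : 0 < e / (2 * C') by rewrite divr_gt0// mulr_gt0.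
    have [N hN] := norm_cvg_near uf e1; exists N => m n Nm Nn.
    apply: le_trans (Gbound (GB _ _ _ _ (hu' m) (hu' n))) _.
    have h1 : rnorm (u m - u n) <= e / C'.
      have := hN _ Nm; have := hN _ Nn; have := rnormD (u m - f) (f - u n).
      rewrite addrA subrK (rnorm_distC f) invfM mulrCA.
      by move: (e * C'^-1) => x; lra.
    apply: (@le_trans _ _ (C' * (e / C'))); last by rewrite mulrCA divff ?mulr1 ?gt_eqF.
    by apply: ler_pM; rewrite ?rnorm_ge0// lerDl.
  by exists l, u, u'.
have Gbar_lin c f g f' g' : Gbar f f' -> Gbar g g' ->
    Gbar (c *: f + g) (c *: f' + g').
  move=> [u [u' [Gu uf uf']]] [v [v' [Gv vg vg']]].
  exists (fun n => c *: u n + v n), (fun n => c *: u' n + v' n).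
  by split; [move=> n; exact: Glin | exact: norm_cvg_linear | exact: norm_cvg_linear].
have Gbar_bound f f' : Gbar f f' -> rnorm f' <= C * rnorm f.
  move=> [u [u' [Gu /norm_cvg_rnorm uf /norm_cvg_rnorm uf']]].
  have Cu : (fun n => C * rnorm (u n)) @ \oo --> C * rnorm f.
    by apply: cvgM uf; exact: cvg_cst.
  by apply: ler_cvg_to uf' Cu _; apply: nearW => n; exact: Gbound.
have Gbar_fun f f1 f2 : Gbar f f1 -> Gbar f f2 -> f1 = f2.
  move=> h1 h2; have := Gbar_bound _ _ (Gbar_lin (-1) _ _ _ _ h2 h1).
  rewrite !scaleN1r addNr rnorm0 mulr0 => h.
  have /rnorm_eq0/eqP : rnorm (- f2 + f1) = 0 by apply/eqP; rewrite eq_le h rnorm_ge0.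
  by rewrite addrC subr_eq0 => /eqP.
have [T hT] := choice Gbar_ex.
have Tlin : linear T.
  by move=> c f g; apply: Gbar_fun (hT _) _; exact: Gbar_lin.
pose TL := GRing.isLinear.Build _ _ _ _ T Tlin.
exists (HB.pack_for {linear V -> W} T TL); split => /=; last first.
  by move=> f; exact: Gbar_bound.
move=> f f' Gff'; apply: Gbar_fun (hT _) _.
by exists (fun=> f), (fun=> f'); split=> //; exact: norm_cvg_cst.
Qed.

End BoundedExtension.

(** * Identity theorems for power series on a real segment *)

Section PowerSeries.
Variables (R : realType) (V : normedModType R[i]).

(** As [t] tends to 0 the first nonzero coefficient would dominate the sum. *)
Lemma vanishing_coefs (c : nat -> V) (n : nat) (D eps : R) : 0 < eps ->
  (forall t, 0 < t <= eps ->
     rnorm (\sum_(0 <= k < n) ((t ^+ k)%:C)%C *: c k) <= D * t ^+ n) ->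
  forall k, (k < n)%N -> c k = 0.
Proof.
move=> eps0 small; elim/ltn_ind => k IH kn.
pose E := `|D| + \sum_(k.+1 <= j < n) rnorm (c j).
have E0 : 0 <= E by rewrite addr_ge0// sumr_ge0// => j _; exact: rnorm_ge0.
have bound t : 0 < t -> t <= Num.min 1 eps -> rnorm (c k) <= t * E.
  rewrite le_min => t0 /andP[t1 te].
  have /small : 0 < t <= eps by rewrite t0 te.
  rewrite (big_cat_nat (n := k) (p := n)) ?(ltnW kn)//= big_nat big1 ?add0r; last first.
    by move=> j /andP[_ jk]; rewrite IH ?scaler0// (ltn_trans jk).
  rewrite big_ltn//; set tail := (\sum_(k.+1 <= j < n) _) => sm.
  have tl : rnorm tail <= t ^+ k.+1 * \sum_(k.+1 <= j < n) rnorm (c j).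
    apply: le_trans (rnorm_sum _ _ _) _; rewrite mulr_sumr.
    rewrite [leRHS]big_nat_cond [leLHS]big_nat_cond.
    apply: ler_sum => j /andP[/andP[kj _] _]; rewrite rnormZ rnorm_real.
    apply: ler_wpM2r; rewrite ?rnorm_ge0// ger0_norm ?exprn_ge0 ?(ltW t0)//.
    by apply: ler_wiXn2l => //; exact: ltW.
  have Dn : D * t ^+ n <= t ^+ k.+1 * `|D|.
    rewrite mulrC; apply: (@le_trans _ _ (t ^+ n * `|D|)).
      by rewrite ler_wpM2l ?exprn_ge0 ?ler_norm// ltW.
    apply: ler_wpM2r => //.
    by apply: ler_wiXn2l => //; exact: ltW.
  have := rnormB (((t ^+ k)%:C)%C *: c k + tail) tail; rewrite addrK rnormZ rnorm_real.
  rewrite ger0_norm ?exprn_ge0 ?(ltW t0)// => h.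
  rewrite -(@ler_pM2l _ (t ^+ k)) ?exprn_gt0// mulrA -exprSr /E mulrDr.
  by apply: le_trans h _; apply: lerD tl; exact: le_trans Dn.
apply: rnorm_eq0; apply/eqP; rewrite eq_le rnorm_ge0 andbT.
apply/ler_addgt0Pr => e e0; rewrite add0r.
pose t := Num.min (Num.min 1 eps) (e / (1 + E)).
have E1 : 0 < 1 + E by rewrite ltr_pwDl.
have t0 : 0 < t by rewrite !lt_min ltr01 eps0 divr_gt0.
apply: le_trans (bound t t0 _) _; first by rewrite ge_min lexx.
apply: (@le_trans _ _ (e / (1 + E) * (1 + E))); last by rewrite divfK ?gt_eqF.
apply: ler_pM => //; [exact: ltW | by rewrite ge_min lexx orbT | by rewrite lerDr].
Qed.

Lemma geometric_tail (t : R) (m n : nat) : 0 <= t -> t <= 2^-1 ->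
  \sum_(m <= k < n) t ^+ k <= 2 * t ^+ m.
Proof.
move=> t0 t2; have tm k : 0 <= t ^+ k by rewrite exprn_ge0.
have [n_le_m|mn] := leqP n m; first by rewrite big_geq// mulr_ge0.
have : (1 - t) * \sum_(m <= k < n) t ^+ k <= t ^+ m.
  rewrite mulr_sumr (eq_bigr (fun k => - (t ^+ k.+1 - t ^+ k))); last first.
    by move=> k _; rewrite exprS mulrBl mul1r opprB.
  by rewrite sumrN telescope_sumr ?(ltnW mn)// opprB lerBlDr lerDl.
have : 0 <= \sum_(m <= k < n) t ^+ k by rewrite sumr_ge0.
move: (\sum_(m <= k < n) _) (tm m) => x; nra.
Qed.

(** Convergence at [t = 1] bounds the coefficients, hence the remainder after
degree [k] is [O(t^(k+1))] and the partial sums satisfy [vanishing_coefs]. *)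
Lemma power_series_unique (c : nat -> V) :
  (forall t : R, 0 < t <= 1 ->
     norm_cvg (fun n => \sum_(0 <= k < n) ((t ^+ k)%:C)%C *: c k) 0) ->
  forall k, c k = 0.
Proof.
move=> cv0.
have [N hN] : exists N, forall n, (N <= n)%N -> rnorm (c n) <= 2.
  have h1 : 0 < (1 : R) <= 1 by rewrite ltr01 lexx.
  have [N hN] := norm_cvg_near (cv0 1 h1) ltr01; exists N => n Nn.
  have := hN n Nn; have := hN n.+1 (leqW Nn); rewrite !subr0.
  rewrite big_nat_recr//= expr1n scale1r; set S := \sum_(0 <= k < n) _.
  by have := rnormB (S + c n) S; rewrite [S + _]addrC addrK; lra.
pose D := 2 + \sum_(0 <= k < N) rnorm (c k).
have cD n : rnorm (c n) <= D.
  have [Nn|nN] := leqP N n.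
    by apply: le_trans (hN n Nn) _; rewrite lerDl sumr_ge0// => k _; exact: rnorm_ge0.
  rewrite /D (big_cat_nat (n := n) (p := N)) ?(ltnW nN)//= (big_ltn nN).
  have sum0 i j : 0 <= \sum_(i <= k < j) rnorm (c k).
    by rewrite sumr_ge0// => k _; exact: rnorm_ge0.
  by have := sum0 0%N n; have := sum0 n.+1 N; lra.
move=> k; apply: (@vanishing_coefs c k.+1 (2 * D) 2^-1) => // t /andP[t0 t2].
have t1 : t <= 1 by lra.
have D0 : 0 <= D by apply: le_trans (cD 0%N); exact: rnorm_ge0.
rewrite -rnormN -sub0r; apply: (norm_cvg_bound (cv0 t _)); first by rewrite t0 t1.
exists k.+1 => n kn; rewrite (big_cat_nat (n := k.+1) (p := n))//=.
rewrite addrAC subrr add0r; apply: le_trans (rnorm_sum _ _ _) _.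
apply: (@le_trans _ _ (D * \sum_(k.+1 <= j < n) t ^+ j)).
  rewrite mulr_sumr; apply: ler_sum => j _; rewrite rnormZ rnorm_real mulrC.
  by rewrite ger0_norm ?exprn_ge0 ?(ltW t0)// ler_wpM2r ?exprn_ge0 ?(ltW t0).
rewrite -mulrA mulrCA; apply: ler_wpM2l => //.
exact: geometric_tail (ltW t0) t2.
Qed.

End PowerSeries.

(** * Complex Euclidean space *)

Section ComplexVectors.
Variables (R : realType) (d : nat).
Implicit Types z w u : CVec R d.
Local Notation conj := Num.conj.

Lemma cdotDl z w u : cdot (z + w) u = cdot z u + cdot w u.
Proof. by rewrite /cdot -big_split; apply: eq_bigr => i _; rewrite mxE mulrDl. Qed.

Lemma cdotZl (c : Cplx R) z w : cdot (c *: z) w = c * cdot z w.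
Proof. by rewrite /cdot big_distrr; apply: eq_bigr => i _; rewrite mxE /= mulrA. Qed.

Lemma cdotC z w : cdot w z = conj (cdot z w).
Proof.
rewrite /cdot rmorph_sum; apply: eq_bigr => i _.
by rewrite rmorphM mulrC; congr (_ * _); apply/esym; exact: conjcK.
Qed.

Lemma cdotDr z w u : cdot u (z + w) = cdot u z + cdot u w.
Proof. by rewrite cdotC cdotDl rmorphD /= -!cdotC. Qed.

Lemma cdotZr (c : Cplx R) z w : cdot w (c *: z) = conj c * cdot w z.
Proof. by rewrite cdotC cdotZl rmorphM /= -cdotC. Qed.

Lemma cdotNl z w : cdot (- z) w = - cdot z w.
Proof. by rewrite -scaleN1r cdotZl mulN1r. Qed.

Lemma cdotNr z w : cdot w (- z) = - cdot w z.
Proof. by rewrite cdotC cdotNl rmorphN /= -cdotC. Qed.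

Lemma enorm_ge0 z : 0 <= enorm z.
Proof. exact: sqrtr_ge0. Qed.

Lemma enorm_sqr z : enorm z ^+ 2 = \sum_(i < d) rnorm (z 0 i) ^+ 2.
Proof. by rewrite sqr_sqrtr// sumr_ge0// => i _; exact: sqr_ge0. Qed.

Lemma cdotff z : cdot z z = ((enorm z ^+ 2)%:C)%C.
Proof.
rewrite enorm_sqr rmorph_sum; apply: eq_bigr => i _.
exact: (rnorm_mulJ (z 0 i)).
Qed.

Lemma enorm_cdot z w : cdot z z = cdot w w -> enorm z = enorm w.
Proof.
rewrite !cdotff => -[]/eqP; rewrite eqrXn2 ?enorm_ge0//.
by move/eqP.
Qed.

Lemma enormZ (c : Cplx R) z : enorm (c *: z) = rnorm c * enorm z.
Proof.
apply/eqP; rewrite -(@eqrXn2 _ 2) ?mulr_ge0 ?enorm_ge0 ?rnorm_ge0//.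
rewrite exprMn !enorm_sqr mulr_sumr; apply/eqP/eq_bigr => i _.
by rewrite mxE -exprMn -rnormM.
Qed.

Lemma enorm0 : enorm (0 : CVec R d) = 0.
Proof. by rewrite -(scale0r 0) enormZ rnorm0 mul0r. Qed.

Lemma enorm_eq0 z : enorm z = 0 -> z = 0.
Proof.
move=> z0; have := enorm_sqr z; rewrite z0 expr0n/= => /esym/eqP.
rewrite psumr_eq0 => [/allP h|i _]; last exact: sqr_ge0.
apply/rowP => i; rewrite mxE; apply/rnorm_eq0/eqP.
by have := h i (mem_index_enum i); rewrite sqrf_eq0.
Qed.

(** The Cauchy-Schwarz inequality again, for the concrete inner product. *)
Lemma rnorm_cdot z w : rnorm (cdot z w) <= enorm z * enorm w.
Proof.
have [->|z0] := eqVneq w 0.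
  by rewrite -(scale0r 0) cdotZr rmorph0 mul0r rnorm0 scale0r enorm0 mulr0.
have w0 : 0 < enorm w.
  by rewrite lt_neqAle enorm_ge0 andbT eq_sym; apply: contra_neq z0 => /enorm_eq0.
pose u := ((enorm w ^+ 2)%:C)%C *: z - cdot z w *: w.
have E : cdot u u = ((enorm w ^+ 2 * ((enorm z * enorm w) ^+ 2 - rnorm (cdot z w) ^+ 2))%:C)%C.
  rewrite /u !(cdotDl, cdotDr, cdotNl, cdotNr, cdotZl, cdotZr) !cdotff (cdotC z w).
  rewrite (conjc_real _ : Num.conj (_%:C)%C = (_%:C)%C).
  set Z : R[i] := ((enorm z ^+ 2)%:C)%C; set W : R[i] := ((enorm w ^+ 2)%:C)%C.
  have -> : ((enorm w ^+ 2 * ((enorm z * enorm w) ^+ 2 - rnorm (cdot z w) ^+ 2))%:C)%C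
      = W * (Z * W - cdot z w * conj (cdot z w)) :> R[i].
    by rewrite rnorm_mulJ -rmorphM -rmorphB -rmorphM exprMn.
  by ring.
have : 0 <= enorm u ^+ 2 by rewrite sqr_ge0.
have -> : enorm u ^+ 2 = enorm w ^+ 2 * ((enorm z * enorm w) ^+ 2 - rnorm (cdot z w) ^+ 2).
  by move: E; rewrite cdotff => -[].
rewrite pmulr_rge0 ?exprn_gt0// subr_ge0 => h.
by rewrite -(@ler_pXn2r _ 2) // ?nnegrE ?mulr_ge0 ?enorm_ge0 ?rnorm_ge0.
Qed.

Variable a : nat -> R.
Hypothesis ga : generating_function a.

(** In all cases the domain is a ball centred at the origin. *)
Lemma natural_domain_sub z w : natural_domain d a z -> enorm w <= enorm z ->
  natural_domain d a w.
Proof.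
rewrite /natural_domain; case: (conv_radius a) => [rho||] //.
by case: ifP => _ /= h1 h2; [exact: le_trans h1 | exact: le_lt_trans h1].
Qed.

Lemma natural_domainZ (c : Cplx R) z : natural_domain d a z -> rnorm c <= 1 ->
  natural_domain d a (c *: z).
Proof.
move=> Xz c1; apply: (natural_domain_sub Xz).
by rewrite enormZ ler_piMl ?enorm_ge0.
Qed.

Lemma natural_domain0 : natural_domain d a 0.
Proof.
have [_ _] := ga; rewrite /natural_domain; case: (conv_radius a) => [rho||] //=.
rewrite lte_fin => rho0.
by case: ifP => _ /=; rewrite enorm0 ?sqrtr_ge0// sqrtr_gt0.
Qed.

End ComplexVectors.

(** * Homogeneous expansion in a weighted Hardy space *)

Section HomogeneousExpansion.
Variables (R : realType) (d : nat) (H : weighted_hardy R d).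

Local Notation conj := Num.conj.
Local Notation a := (wh_coef H).
Local Notation X := (natural_domain d a).
Local Notation dot := (rk_dot H).
Local Notation mono := (wh_monomial H).
Let dotE := @rk_normE R _ _ H.

(** The multi-indices of degree [n] have entries at most [n], so that they can be
enumerated through a finite type. *)
Definition degree_index n (x : {ffun 'I_d -> 'I_n.+1}) : multi_index d :=
  [ffun i => val (x i)].

Lemma degree_index_inj n : injective (@degree_index n).
Proof.
by move=> x y /ffunP h; apply/ffunP => i; have := h i; rewrite !ffunE => /val_inj.
Qed.

Lemma degree_indexP n (alpha : multi_index d) : mi_deg alpha = n ->
  exists x : {ffun 'I_d -> 'I_n.+1}, degree_index x = alpha.
Proof.
move=> an; exists [ffun i => inord (alpha i)].
apply/ffunP => i; rewrite !ffunE /= inordK// ltnS -an.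
by rewrite /mi_deg (bigD1 i)//= leq_addr.
Qed.

(** The homogeneous element of degree [n] whose inner product with each monomial
[alpha] of that degree is [c alpha]. *)
Definition homog n (c : multi_index d -> Cplx R) : H :=
  \sum_(x : {ffun 'I_d -> 'I_n.+1} | mi_deg (degree_index x) == n)
    (c (degree_index x) / ((rnorm (mono (degree_index x)) ^+ 2)%:C)%C) *:
      mono (degree_index x).

Lemma rnorm_mono_neq0 alpha : ((rnorm (mono alpha) ^+ 2)%:C)%C != 0 :> R[i].
Proof.
apply/eqP => -[]/eqP; rewrite sqrf_eq0 => /eqP/rnorm_eq0/eqP.
by rewrite (negPf (wh_monomial_neq0 H alpha)).
Qed.

Lemma dot_homog_mono n c alpha : dot (homog n c) (mono alpha) =
  if mi_deg alpha == n then c alpha else 0.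
Proof.
rewrite /homog dot_suml; case: ifPn => [/eqP an|an].
  have [x xa] := degree_indexP an.
  rewrite (bigD1 x) ?xa ?an//= dotZl (dotff dotE) divfK ?rnorm_mono_neq0//.
  rewrite big1 ?addr0// => y /andP[_ yx]; rewrite dotZl wh_orthogonal ?mulr0//.
  by rewrite -xa; apply: contra_neq yx => /degree_index_inj.
rewrite big1// => x /eqP xn; rewrite dotZl wh_orthogonal ?mulr0//.
by apply: contraNneq an => <-; rewrite xn.
Qed.

Lemma dot_homog_homog m n c e : m != n -> dot (homog m c) (homog n e) = 0.
Proof.
move=> mn; rewrite {2}/homog dot_sumr big1// => x /eqP xn.
by rewrite dotZr dot_homog_mono xn eq_sym (negPf mn) mulr0.
Qed.

Lemma dot_homogr n c f : dot f (homog n c) =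
  dot (homog n (fun alpha => dot f (mono alpha))) (homog n c).
Proof.
rewrite [homog n c]/homog !dot_sumr; apply: eq_bigr => x xn.
by rewrite !dotZr dot_homog_mono xn.
Qed.

Definition psum c N : H := \sum_(0 <= n < N) homog n c.

Lemma psum_cvg c B : (forall N, rnorm (psum c N) <= B) ->
  exists l, norm_cvg (psum c) l.
Proof. exact: orthogonal_series_cvg dotE _ _ (fun k l => @dot_homog_homog k l c c). Qed.

Lemma dot_psum_mono c l alpha : norm_cvg (psum c) l -> dot l (mono alpha) = c alpha.
Proof.
move=> cl; apply: (norm_cvg_unique (norm_cvg_dotl dotE (mono alpha) cl)).
rewrite /norm_cvg; apply/cvgrPdist_le => e e0; exists (mi_deg alpha).+1 => // N /= hN.
rewrite /psum dot_suml big_mkord (bigD1 (Ordinal hN))//= dot_homog_mono eqxx.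
rewrite big1 ?addr0 ?subrr ?rnorm0 ?subr0 ?normr0 ?(ltW e0)// => i hi.
rewrite dot_homog_mono ifN//; apply: contra_neq hi => hi; exact: val_inj.
Qed.

(** The partial sums are orthogonal projections of [f], hence bounded (Bessel), and
their limit has the same inner products with monomials as [f]. *)
Lemma homog_expansion f : norm_cvg (psum (fun alpha => dot f (mono alpha))) f.
Proof.
set c := fun alpha => _.
have bd N : rnorm (psum c N) <= rnorm f.
  have E : dot f (psum c N) = ((rnorm (psum c N) ^+ 2)%:C)%C.
    rewrite -(dotff dotE) {2}/psum {2}/psum [in RHS]dot_sumr dot_sumr.
    apply: eq_big_nat => n nN; rewrite dot_homogr -/c /psum dot_suml big_mkord.
    case/andP: nN => _ nN; rewrite (bigD1 (Ordinal nN))//= big1 ?addr0// => i hi.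
    by rewrite dot_homog_homog//; apply: contra_neq hi => hi; exact: val_inj.
  have := cauchy_schwarz dotE f (psum c N); rewrite E rnorm_real ger0_norm ?sqr_ge0//.
  have [->|p0] := eqVneq (rnorm (psum c N)) 0; first by rewrite rnorm_ge0.
  by rewrite expr2 ler_pM2r// lt_neqAle eq_sym p0 rnorm_ge0.
have [l cl] := psum_cvg bd.
rewrite (_ : f = l)//; apply/eqP; rewrite -subr_eq0; apply/eqP.
by apply: wh_complete => alpha; rewrite dotBl (dot_psum_mono _ cl) subrr.
Qed.

Lemma rk_ev_sum x (I : Type) (r : seq I) (P : pred I) (F : I -> Cplx R)
    (G : I -> H) : X x ->
  rk_ev (\sum_(i <- r | P i) F i *: G i) x = \sum_(i <- r | P i) F i * rk_ev (G i) x.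
Proof.
move=> Xx; have ev0 : rk_ev (0 : H) x = 0.
  by have := rk_ev_linear (-1) (0 : H) 0 Xx; rewrite scaler0 addr0 mulN1r addNr.
elim: r => [|i r IH]; first by rewrite !big_nil.
by rewrite !big_cons; case: ifP => _ //; rewrite rk_ev_linear// IH.
Qed.

(** On polynomials evaluation at [x] is already the inner product with a
polynomial, whatever the kernel is. *)
Lemma rk_ev_homog n c x : X x ->
  rk_ev (homog n c) x = dot (homog n c) (homog n (fun alpha => conj (monomial alpha x))).
Proof.
move=> Xx; rewrite {1}/homog rk_ev_sum// {1}/homog dot_suml.
apply: eq_bigr => y yn; rewrite dotZl; congr (_ * _).
by rewrite wh_monomialE// (dotC dot) dot_homog_mono yn conjCK.
Qed.

Lemma rk_ev_psum c N M x : X x -> (N <= M)%N ->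
  rk_ev (psum c N) x = dot (psum c N) (psum (fun alpha => conj (monomial alpha x)) M).
Proof.
move=> Xx NM; rewrite {1}/psum {1}(eq_bigr (fun n => 1 *: homog n c)) => [|n _]; last by rewrite scale1r.
rewrite rk_ev_sum// [psum c N]/psum dot_suml; apply: eq_big_nat => n /andP[_ nN].
rewrite mul1r rk_ev_homog// /psum dot_sumr big_mkord.
rewrite (bigD1 (Ordinal (leq_trans nN NM)))//= big1 ?addr0// => i hi.
by rewrite dot_homog_homog//; apply: contra_neq hi => hi; exact: val_inj.
Qed.

(** The representing polynomials of [rk_ev_psum] are bounded because evaluation is,
so they converge, and the limit represents evaluation on all of [H].  This is
the Riesz theorem for evaluations, together with an expansion of the
representing vector. *)
Lemma kvec_psum x : X x ->
  norm_cvg (psum (fun alpha => conj (monomial alpha x))) (kvec H x) /\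
  forall f : H, rk_ev f x = dot f (kvec H x).
Proof.
move=> Xx; set c := fun alpha => _.
have [B hB] := rk_ev_bounded H Xx.
have hB' (f : H) : rnorm (rk_ev f x) <= B * rnorm f.
  by have := hB f; rewrite !rnormE -rmorphM lecR.
have [l cl] : exists l, norm_cvg (psum c) l.
  apply: (@psum_cvg _ (Num.max B 0)) => N.
  have := hB' (psum c N); rewrite (rk_ev_psum _ Xx (leqnn N)) (dotff dotE) rnorm_real.
  rewrite ger0_norm ?sqr_ge0//.
  have [->|p0] := eqVneq (rnorm (psum c N)) 0; first by rewrite le_max lexx orbT.
  by rewrite expr2 ler_pM2r ?lt_neqAle 1?eq_sym ?p0 ?rnorm_ge0// le_max => ->.
have repr (f : H) : rk_ev f x = dot f l.
  have ef := homog_expansion f; set cf := fun alpha => _ in ef.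
  have h1 : norm_cvg (fun N => rk_ev (psum cf N) x) (rk_ev f x).
    apply: (@norm_cvg_lip _ _ _ B _ _ _ _ _ ef) => N.
    have -> : rk_ev (psum cf N) x - rk_ev f x = rk_ev (psum cf N - f) x.
      have := rk_ev_linear (-1) f (psum cf N) Xx.
      by rewrite scaleN1r mulN1r (addrC (- f)) (addrC (- rk_ev f x)).
    exact: hB'.
  apply: (norm_cvg_unique h1).
  have := norm_cvg_dotl dotE l ef; congr norm_cvg; apply/funext => N.
  apply: (norm_cvg_unique (norm_cvg_dotr dotE _ cl)).
  rewrite /norm_cvg; apply/cvgrPdist_le => e e0; exists N => // M /= NM.
  by rewrite -rk_ev_psum// subrr rnorm0 subr0 normr0 ltW.
have -> : kvec H x = l; last by [].
have hk (f : H) : rk_ev f x = dot f (kvec H x).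
  have h : exists k : H, [set k : H | forall f : H, rk_ev f x = rk_dot H f k] k.
    by exists l.
  have := xgetPex 0 h; apply.
apply/eqP; rewrite -subr_eq0; apply/eqP/rnorm_eq0/eqP; rewrite -sqrf_eq0; apply/eqP.
by apply: (@complexI R); rewrite -(dotff dotE) dotBr -hk -repr subrr.
Qed.

End HomogeneousExpansion.

(** * Homogeneous parts of the kernel *)

Section KernelComponents.
Variables (R : realType) (d : nat) (H : weighted_hardy R d).

Local Notation conj := Num.conj.
Local Notation a := (wh_coef H).
Local Notation X := (natural_domain d a).
Local Notation dot := (rk_dot H).
Let dotE := @rk_normE R _ _ H.

(** The degree [n] part of the kernel vector at [v]; unlike the kernel vector itself
it makes sense at every point [v]. *)
Definition kpart n (v : CVec R d) : H := homog H n (fun alpha => conj (monomial alpha v)).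

Lemma rk_evE (f : H) x : X x -> rk_ev f x = dot f (kvec H x).
Proof. by move=> /kvec_psum[]. Qed.

Lemma kvec_sum x : X x -> norm_cvg (fun N => \sum_(0 <= n < N) kpart n x) (kvec H x).
Proof. by move=> /kvec_psum[]. Qed.

Lemma dot_kpart_orth v w k n : k != n -> dot (kpart k v) (kpart n w) = 0.
Proof. exact: dot_homog_homog. Qed.

Lemma monomialZ alpha (c : Cplx R) (v : CVec R d) :
  monomial alpha (c *: v) = c ^+ mi_deg alpha * monomial alpha v.
Proof.
rewrite /monomial /mi_deg expr_sum -big_split; apply: eq_bigr => i _ /=.
by rewrite mxE exprMn.
Qed.

Lemma kpartZ n (c : Cplx R) v : kpart n (c *: v) = conj c ^+ n *: kpart n v.
Proof.
rewrite /kpart /homog scaler_sumr; apply: eq_bigr => x /eqP xn.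
by rewrite monomialZ xn rmorphM rmorphXn /= scalerA mulrA.
Qed.

Lemma kpart_real n (t : R) v : kpart n ((t%:C)%C *: v) = ((t ^+ n)%:C)%C *: kpart n v.
Proof.
by rewrite kpartZ (conjc_real t : conj (t%:C)%C = (t%:C)%C) rmorphXn.
Qed.

Lemma dot_kpart_kvec n f x : X x ->
  dot (homog H n f) (kvec H x) = dot (homog H n f) (kpart n x).
Proof.
by move=> Xx; rewrite -rk_evE// rk_ev_homog.
Qed.

(** Replacing [z] by [t z], both sides are the coefficients of power series in [t]
with the same sum: one from the expansion of the kernel vector, the other from
the generating function. *)
Lemma dot_kpart n z w : X z -> X w ->
  dot (kpart n w) (kpart n z) = (a n)%:C%C * cdot z w ^+ n.
Proof.
move=> Xz Xw; apply/eqP; rewrite -subr_eq0; apply/eqP.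
move: n; apply: (@power_series_unique R (Cplx R)) => t /andP[t0 t1].
have Xtz : X ((t%:C)%C *: z).
  by apply: natural_domainZ Xz _; rewrite rnorm_real ger0_norm// ltW.
have h1 := cvg_norm_cvg (wh_kernel Xtz Xw).
have h2 := norm_cvg_dotl dotE (kvec H ((t%:C)%C *: z)) (kvec_sum Xw).
rewrite -rk_evE// in h2.
have := norm_cvg_linear (-1) h1 h2; rewrite scaleN1r addNr; congr norm_cvg.
apply/funext => N; rewrite dot_suml /series /= scaleN1r -sumrN -big_split /=.
apply: eq_bigr => k _; rewrite dot_kpart_kvec// kpart_real dotZr.
rewrite (conjc_real _ : conj (_%:C)%C = (_%:C)%C) cdotZl exprMn -rmorphXn.
by rewrite scalerBr addrC; congr (_ - _); rewrite /GRing.scale /= mulrCA.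
Qed.

Lemma rnorm_kpart n x : X x -> rnorm (kpart n x) ^+ 2 = a n * enorm x ^+ (2 * n).
Proof.
move=> Xx; apply: (@complexI R); rewrite -(dotff dotE) dot_kpart// cdotff.
by rewrite exprM [RHS]rmorphM [X in _ = _ * X]rmorphXn.
Qed.

Lemma ev_kpart n w z : X z -> X w ->
  rk_ev (kpart n w) z = (a n)%:C%C * cdot z w ^+ n.
Proof. by move=> Xz Xw; rewrite rk_ev_homog// -[RHS]dot_kpart. Qed.

Lemma wh_coef_gt0 n : 0 < a n.
Proof. by have [_ ->] := wh_gen H. Qed.

Lemma wh_coef0 : a 0%N = 1.
Proof. by have [] := wh_gen H. Qed.

Lemma natural_domain_origin : X 0.
Proof. exact: natural_domain0 (wh_gen H). Qed.

Lemma kpart0 v : kpart 0 v = kpart 0 0.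
Proof.
rewrite /kpart /homog; apply: eq_bigr => x _.
have h i : degree_index x i = 0%N by rewrite ffunE (ord1 (x i)).
rewrite /monomial; congr ((_ / _) *: _); congr conj.
by apply: eq_bigr => i _; rewrite h.
Qed.

Lemma kpart_at0 n : (0 < n)%N -> kpart n 0 = 0.
Proof. by move=> n0; rewrite -(scale0r 0) kpartZ rmorph0 expr0n gtn_eqF// scale0r. Qed.

Lemma kvec0 : kvec H 0 = kpart 0 0.
Proof.
apply: (norm_cvg_unique (kvec_sum natural_domain_origin)); rewrite /norm_cvg; apply/cvgrPdist_le => e e0.
exists 1%N => // N /= N0; rewrite big_ltn// big_nat big1 ?addr0 ?subrr ?rnorm0 ?subrr ?normr0 ?ltW//.
by move=> k /andP[k0 _]; exact: kpart_at0.
Qed.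

(** The degree 0 part is the constant function 1. *)
Lemma rnorm_kpart0 v : rnorm (kpart 0 v) = 1.
Proof.
apply/eqP; rewrite -(@eqrXn2 _ 2) ?rnorm_ge0// kpart0 rnorm_kpart; last exact: natural_domain_origin.
by rewrite wh_coef0 muln0 expr0 expr1n mulr1.
Qed.

Lemma ev_kpart0 v z : X z -> rk_ev (kpart 0 v) z = 1.
Proof. by move=> Xz; rewrite kpart0 ev_kpart//; [rewrite wh_coef0 expr0 mulr1 | exact: natural_domain_origin]. Qed.

Lemma kvec_total (f : H) : (forall x, X x -> dot f (kvec H x) = 0) -> f = 0.
Proof.
move=> h; apply: rk_ev_inj => x Xx; rewrite !rk_evE// h// dot0l//.
Qed.

End KernelComponents.

(** * Operators that permute kernel vectors *)

Section KernelMaps.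
Variables (R : realType) (d : nat).
Local Notation conj := Num.conj.
Local Notation dom H := (natural_domain d (wh_coef H)).

(** An operator can be prescribed on the kernel vectors as soon as Gram matrices do
not increase by more than the factor [C^2], because these vectors are total. *)
Lemma kernel_extension (H1 H2 : weighted_hardy R d) (h : CVec R d -> H2) (C : R) :
  0 <= C ->
  (forall s : seq (Cplx R * {x : CVec R d | dom H1 x}),
     rnorm (\sum_(p <- s) p.1 *: h (sval p.2)) <=
     C * rnorm (\sum_(p <- s) p.1 *: kvec H1 (sval p.2))) ->
  exists T : {linear H1 -> H2},
    (forall x, dom H1 x -> T (kvec H1 x) = h x) /\
    forall f, rnorm (T f) <= C * rnorm f.
Proof.
move=> C0 gram.
pose G (f : H1) (f' : H2) := exists s : seq (Cplx R * {x : CVec R d | dom H1 x}),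
  f = \sum_(p <- s) p.1 *: kvec H1 (sval p.2) /\
  f' = \sum_(p <- s) p.1 *: h (sval p.2).
have Gk x (Xx : dom H1 x) : G (kvec H1 x) (h x).
  by exists [:: (1, exist _ x Xx)]; rewrite !big_seq1 /= !scale1r.
have [||||T [TG TC]] := @bounded_extension R H1 H2 (rk_dot H1) (@rk_normE _ _ _ H1) G C C0.
- by exists [::]; rewrite !big_nil.
- move=> c f g f' g' [s [-> ->]] [t [-> ->]].
  exists ([seq (c * p.1, p.2) | p <- s] ++ t).
  rewrite !big_cat !big_map !scaler_sumr /=; split; congr (_ + _);
    by apply: eq_bigr => p _; rewrite scalerA.
- by move=> f f' [s [-> ->]].
- by move=> f hf; apply: kvec_total => x Xx; apply: hf (Gk x Xx).
by exists T; split => // x Xx; exact: TG (Gk x Xx).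
Qed.

(** The operator is existential: only its norm bound and its action on points are
ever used, and those compose. *)
Definition kernel_map (H1 H2 : weighted_hardy R d) (C : R)
    (lam : CVec R d -> Cplx R) (phi : CVec R d -> CVec R d) : Prop :=
  [/\ 0 <= C, forall x, dom H1 x -> dom H2 (phi x) &
      exists S : {linear H1 -> H2}, (forall f, rnorm (S f) <= C * rnorm f) /\
        forall x, dom H1 x -> S (kvec H1 x) = conj (lam x) *: kvec H2 (phi x)].

(** Invertibility is recorded on points and weights only. *)
Definition kernel_iso (H1 H2 : weighted_hardy R d) (C C' : R)
    (lam : CVec R d -> Cplx R) (phi : CVec R d -> CVec R d)
    (lam' : CVec R d -> Cplx R) (phi' : CVec R d -> CVec R d) : Prop :=
  [/\ kernel_map H1 H2 C lam phi, kernel_map H2 H1 C' lam' phi',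
      forall x, dom H1 x -> phi' (phi x) = x /\ lam x * lam' (phi x) = 1 &
      forall y, dom H2 y -> phi (phi' y) = y /\ lam' y * lam (phi' y) = 1].

Lemma kernel_map_comp (H1 H2 H3 : weighted_hardy R d) C C' lam lam' phi phi' :
  kernel_map H1 H2 C lam phi -> kernel_map H2 H3 C' lam' phi' ->
  kernel_map H1 H3 (C' * C) (fun x => lam x * lam' (phi x)) (phi' \o phi).
Proof.
move=> [C0 XX [S [SC Sk]]] [C'0 XX' [S' [SC' Sk']]]; split.
- exact: mulr_ge0.
- by move=> x Xx; apply: XX'; exact: XX.
exists (S' \o S)%FUN; split=> [f|x Xx] /=.
  by apply: le_trans (SC' _) _; rewrite -mulrA ler_wpM2l.
by rewrite Sk// linearZ Sk'/= ?scalerA -?rmorphM//; exact: XX.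
Qed.

Lemma kernel_iso_sym (H1 H2 : weighted_hardy R d) C C' lam lam' phi phi' :
  kernel_iso H1 H2 C C' lam phi lam' phi' ->
  kernel_iso H2 H1 C' C lam' phi' lam phi.
Proof. by case. Qed.

Lemma kernel_iso_comp (H1 H2 H3 : weighted_hardy R d) C1 C1' C2 C2'
    lam1 lam1' lam2 lam2' phi1 phi1' phi2 phi2' :
  kernel_iso H1 H2 C1 C1' lam1 phi1 lam1' phi1' ->
  kernel_iso H2 H3 C2 C2' lam2 phi2 lam2' phi2' ->
  kernel_iso H1 H3 (C2 * C1) (C1' * C2')
    (fun x => lam1 x * lam2 (phi1 x)) (phi2 \o phi1)
    (fun y => lam2' y * lam1' (phi2' y)) (phi1' \o phi2').
Proof.
move=> [m1 m1' i1 i1'] [m2 m2' i2 i2']; split.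
- exact: kernel_map_comp m1 m2.
- exact: kernel_map_comp m2' m1'.
- move=> x Xx /=; have X2 : dom H2 (phi1 x) by case: m1 => _ + _; apply.
  have [-> e2] := i2 _ X2; have [-> e1] := i1 _ Xx; split=> //.
  by rewrite -mulrA (mulrA (lam2 _)) e2 mul1r.
- move=> y Xy /=; have X2 : dom H2 (phi2' y) by case: m2' => _ + _; apply.
  have [-> e1] := i1' _ X2; have [-> e2] := i2' _ Xy; split=> //.
  by rewrite -mulrA (mulrA (lam1' _)) e1 mul1r.
Qed.

Lemma dot_kvec_sum (H : weighted_hardy R d) x y : dom H x -> dom H y ->
  norm_cvg (series (fun n => (wh_coef H n)%:C%C * cdot y x ^+ n : Cplx R))
    (rk_dot H (kvec H x) (kvec H y)).
Proof. by move=> Xx Xy; rewrite -rk_evE//; apply: cvg_norm_cvg; exact: wh_kernel. Qed.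

(** The kernel depends on inner products only, so an inner product preserving map
preserves Gram matrices of kernel vectors. *)
Lemma unitary_kernel_map (H : weighted_hardy R d) (W : CVec R d -> CVec R d) :
  (forall x y, cdot (W x) (W y) = cdot x y) ->
  kernel_map H H 1 (fun=> 1) W.
Proof.
move=> Wiso; have XW x : dom H x -> dom H (W x).
  by move=> Xx; apply: (natural_domain_sub Xx); rewrite (@enorm_cdot _ _ (W x) x).
split=> //; have [|s|T [Tk TC]] := @kernel_extension H H (kvec H \o W) 1.
- exact: ler01.
- rewrite mul1r -(@ler_pXn2r _ 2) ?nnegrE ?rnorm_ge0// le_eqVlt; apply/orP; left.
  apply/eqP/(@complexI R); rewrite -!(dotff (@rk_normE _ _ _ H)) !dot_suml.
  apply: eq_bigr => p _; rewrite !dot_sumr; apply: eq_bigr => q _.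
  rewrite !dotZl !dotZr; congr (_ * (_ * _)) => /=.
  have Xp := svalP p.2; have Xq := svalP q.2.
  apply: (norm_cvg_unique (dot_kvec_sum (XW _ Xp) (XW _ Xq))).
  by rewrite Wiso; exact: dot_kvec_sum.
exists T; split=> // x Xx; rewrite Tk// rmorph1 scale1r//.
Qed.

Lemma unitary_kernel_iso (H : weighted_hardy R d) (W W' : CVec R d -> CVec R d) :
  (forall x y, cdot (W x) (W y) = cdot x y) ->
  (forall x y, cdot (W' x) (W' y) = cdot x y) ->
  cancel W W' -> cancel W' W ->
  kernel_iso H H 1 1 (fun=> 1) W (fun=> 1) W'.
Proof.
move=> h h' c c'; split; try exact: unitary_kernel_map.
- by move=> x _; rewrite c mulr1.
- by move=> x _; rewrite c' mulr1.
Qed.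

(** For [e + conj e = <u, u>] this is the unitary map that fixes the orthogonal of
[u] and multiplies [u] by [- conj e / e]. *)
Definition complex_reflection (u : CVec R d) (e : Cplx R) (x : CVec R d) : CVec R d :=
  x - (cdot x u / e) *: u.

Lemma complex_reflection_isometry u (e : Cplx R) : e != 0 -> e + conj e = cdot u u ->
  forall x z, cdot (complex_reflection u e x) (complex_reflection u e z) = cdot x z.
Proof.
move=> e0 eu x z; have e'0 : conj e != 0 by rewrite fmorph_eq0.
rewrite /complex_reflection.
rewrite !(cdotDl, cdotDr, cdotNl, cdotNr, cdotZl, cdotZr) -eu rmorphM fmorphV /=.
rewrite -(cdotC z u).
by field; rewrite e0 e'0.
Qed.

Lemma complex_reflectionK u (e : Cplx R) : e != 0 -> e + conj e = cdot u u ->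
  cancel (complex_reflection u e) (complex_reflection u (conj e)).
Proof.
move=> e0 eu x; have e'0 : conj e != 0 by rewrite fmorph_eq0.
rewrite /complex_reflection cdotDl cdotNl cdotZl -eu -addrA -opprD -scalerDl.
rewrite [X in X *: u](_ : _ = 0) ?scale0r ?subr0//.
by field; rewrite e0 e'0.
Qed.

(** A complex reflection along [u = p - y], with [e = <p, u>]: then [W p = p - u = y],
and [|p| = |y|] is exactly the condition [2 Re e = |u|^2] for unitarity. *)
Lemma unitary_transitive (p y : CVec R d) : enorm p = enorm y ->
  exists W W' : CVec R d -> CVec R d,
  [/\ W p = y, forall x z, cdot (W x) (W z) = cdot x z,
      forall x z, cdot (W' x) (W' z) = cdot x z, cancel W W' & cancel W' W].
Proof.
move=> py; have [->|neq] := eqVneq p y; first by exists id, id.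
pose u := p - y; pose c : Cplx R := cdot p u.
have uu : cdot u u = c + conj c.
  rewrite /c -cdotC /u !(cdotDl, cdotDr, cdotNl, cdotNr) !cdotff py.
  by ring.
have c0 : c != 0.
  apply: contra_neq neq => c0; apply/eqP; rewrite -subr_eq0 -/u; apply/eqP/enorm_eq0.
  move: uu; rewrite c0 rmorph0 addr0 cdotff => -[]/eqP.
  by rewrite sqrf_eq0 => /eqP.
have c'0 : conj c != 0 by rewrite fmorph_eq0.
have cc : conj c + conj (conj c) = cdot u u by rewrite conjCK addrC.
exists (complex_reflection u c), (complex_reflection u (conj c)); split.
- by rewrite /complex_reflection -/c divff// scale1r /u opprB addrC subrK.
- exact: complex_reflection_isometry.
- exact: complex_reflection_isometry.
- exact: complex_reflectionK.
- by rewrite -{2}(conjCK c); exact: complex_reflectionK.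
Qed.

End KernelMaps.

(** * A Schwarz lemma for maps fixing the origin *)

Section FixedOrigin.
Variables (R : realType) (d : nat) (H1 H2 : weighted_hardy R d).
Local Notation conj := Num.conj.
Local Notation dom H := (natural_domain d (wh_coef H)).
Local Notation a := (wh_coef H1).
Local Notation b := (wh_coef H2).

Definition ktail (H : weighted_hardy R d) n x : H :=
  kvec H x - \sum_(0 <= k < n) kpart H k x.

(** Scaling by [t] multiplies the part of degree [k >= n] by [t^k <= t^n]. *)
Lemma ktail_scale (H : weighted_hardy R d) n (t : R) x : dom H x ->
  0 <= t <= 1 -> rnorm (ktail H n ((t%:C)%C *: x)) <= t ^+ n * rnorm (ktail H n x).
Proof.
move=> Xx /andP[t0 t1].
have Xtx : dom H ((t%:C)%C *: x).
  by apply: natural_domainZ Xx _; rewrite rnorm_real ger0_norm.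
pose c k : Cplx R := ((t ^+ k)%:C)%C.
have E N : \sum_(0 <= k < N) kpart H k ((t%:C)%C *: x) =
    \sum_(0 <= k < N) c k *: kpart H k x.
  by apply: eq_bigr => k _; rewrite kpart_real.
rewrite /ktail E.
apply: (rnorm_multiplier_tail (@rk_normE _ _ _ H) _ (kvec_sum Xx)).
- by move=> k j kj; exact: dot_kpart_orth.
- by have := kvec_sum Xtx; congr norm_cvg; apply/funext => N; exact: E.
- by move=> k nk; rewrite rnorm_real ger0_norm ?exprn_ge0//; exact: ler_wiXn2l.
Qed.

Lemma ktail_le (H : weighted_hardy R d) n x : dom H x ->
  rnorm (ktail H n x) <= 2 * rnorm (kvec H x).
Proof.
move=> Xx; have := rnormB (kvec H x) (\sum_(0 <= k < n) kpart H k x).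
have := @rnorm_partial_sum _ _ _ (@rk_normE _ _ _ H) (fun k => kpart H k x) (kvec H x)
  (fun k j kj => dot_kpart_orth H x x kj) (kvec_sum Xx) n.
rewrite /ktail; lra.
Qed.

Lemma ktail0 (H : weighted_hardy R d) x : ktail H 0 x = kvec H x.
Proof. by rewrite /ktail big_geq// subr0. Qed.

Lemma ktail1 (H : weighted_hardy R d) x : ktail H 1 x = kvec H x - kvec H 0.
Proof. by rewrite /ktail big_nat1 kpart0 kvec0. Qed.

Lemma ktailS (H : weighted_hardy R d) n x :
  ktail H n x = kpart H n x + ktail H n.+1 x.
Proof. by rewrite /ktail big_nat_recr//= opprD addrCA (addrCA (kpart _ _ _)) subrr addr0. Qed.

Variables (C : R) (lam : CVec R d -> Cplx R) (phi : CVec R d -> CVec R d).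
Variable S : {linear H1 -> H2}.
Hypothesis C0 : 0 <= C.
Hypothesis domP : forall x, dom H1 x -> dom H2 (phi x).
Hypothesis SC : forall f, rnorm (S f) <= C * rnorm f.
Hypothesis Sk : forall x, dom H1 x -> S (kvec H1 x) = conj (lam x) *: kvec H2 (phi x).

(** The adjoint of [S] is the weighted composition [f |-> lam * (f \o phi)]. *)
Lemma dot_S (f : H2) x : dom H1 x ->
  rk_dot H2 f (S (kvec H1 x)) = lam x * rk_ev f (phi x).
Proof. by move=> Xx; rewrite Sk// dotZr conjCK rk_evE//; exact: domP. Qed.

Lemma rnorm_dot_S (f : H2) (g : H1) : rnorm (rk_dot H2 f (S g) : Cplx R) <= rnorm f * (C * rnorm g).
Proof.
apply: le_trans (cauchy_schwarz (@rk_normE _ _ _ H2) _ _) _.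
by rewrite ler_wpM2l ?rnorm_ge0.
Qed.

(** The weight is the image of the constant function 1 under the adjoint. *)
Lemma lamE x : dom H1 x -> lam x = rk_dot H2 (kpart H2 0 0) (S (kvec H1 x)).
Proof. by move=> Xx; rewrite dot_S// ev_kpart0 ?mulr1//; exact: domP. Qed.

Lemma rnorm_lam x : dom H1 x -> rnorm (lam x) <= C * rnorm (kvec H1 x).
Proof.
move=> Xx; rewrite lamE//; apply: le_trans (rnorm_dot_S _ _) _.
by rewrite rnorm_kpart0 mul1r.
Qed.

Lemma rnorm_lam_dist x : dom H1 x -> rnorm (lam x - lam 0) <= C * rnorm (ktail H1 1 x).
Proof.
move=> Xx; rewrite !lamE//; last exact: natural_domain_origin.
rewrite -dotBr -linearB -ktail1; apply: le_trans (rnorm_dot_S _ _) _.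
by rewrite rnorm_kpart0 mul1r.
Qed.

Hypothesis phi0 : phi 0 = 0.
Hypothesis lam0 : lam 0 != 0.

Lemma rnorm_lam0 : 0 < rnorm (lam 0).
Proof. by rewrite lt_neqAle rnorm_ge0 andbT eq_sym; apply: contra_neq lam0 => /rnorm_eq0. Qed.

(** The constant term of the image of a linear form under the adjoint is its value
at [phi 0 = 0], so only the tail of degree at least 1 contributes. *)
Lemma rnorm_cdot_phi x v : dom H1 x -> dom H2 v ->
  rnorm (lam x) * b 1%N * rnorm (cdot (phi x) v) <= rnorm (kpart H2 1 v) * (C * rnorm (ktail H1 1 x)).
Proof.
move=> Xx Xv.
have cdot0 : cdot 0 v = 0 by rewrite -(scale0r 0) cdotZl mul0r.
have := rnorm_dot_S (kpart H2 1 v) (ktail H1 1 x).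
rewrite ktail1 linearB dotBr !dot_S//; last exact: natural_domain_origin.
rewrite phi0 !ev_kpart//; try exact: domP; try exact: natural_domain_origin.
rewrite cdot0 !expr1 mulr0 mulr0 subr0.
by rewrite !rnormM rnorm_real gtr0_norm ?wh_coef_gt0// mulrA.
Qed.

(** The image of [<., v>^n] under the adjoint is [lam * <phi, v>^n], which is
[O(t^n)] along [t u] since [<phi, v>] is [O(t)] and [lam] does not vanish near
the origin.  Its coefficients of degree less than [n] are therefore zero. *)
Lemma dot_S_lower k n u v : (k < n)%N -> dom H1 u -> dom H2 v ->
  rk_dot H2 (kpart H2 n v) (S (kpart H1 k u)) = 0.
Proof.
move=> kn Xu Xv.
pose L := rnorm (lam 0); have L0 : 0 < L := rnorm_lam0.
pose D1 := C * rnorm (ktail H1 1 u).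
have D10 : 0 <= D1 by rewrite mulr_ge0 ?rnorm_ge0.
(* Up to this [t] the weight is at least half as large as at the origin. *)
pose eps := Num.min 1 (L / (2 * (1 + D1))).
have eps0 : 0 < eps by rewrite lt_min ltr01 divr_gt0// mulr_gt0// ltr_pwDl.
pose E := rnorm (kpart H2 1 v) * D1 / (b 1%N * (L / 2)).
have b10 := wh_coef_gt0 H2 1; have bn0 := wh_coef_gt0 H2 n.
pose D := C * (2 * rnorm (kvec H1 u)) * (b n * E ^+ n) +
  rnorm (kpart H2 n v) * (C * rnorm (ktail H1 n u)).
pose c j : Cplx R := rk_dot H2 (kpart H2 n v) (S (kpart H1 j u)).
apply: (@vanishing_coefs _ (Cplx R) c n D eps) kn => // t /andP[t0 te].
have t1 : t <= 1 by apply: le_trans te _; rewrite ge_min lexx.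
have t01 : 0 <= t <= 1 by rewrite ltW.
pose x := (t%:C)%C *: u.
have Xx : dom H1 x by apply: natural_domainZ Xu _; rewrite rnorm_real ger0_norm// ltW.
have tail1 : C * rnorm (ktail H1 1 x) <= t * D1.
  by rewrite mulrCA ler_wpM2l//; have := ktail_scale 1 Xu t01; rewrite expr1.
have lamL : L / 2 <= rnorm (lam x).
  have := rnorm_lam_dist Xx; have := rnormB (lam x) (lam x - lam 0).
  rewrite opprB addrC subrK -/L.
  have : t * D1 <= L / 2.
    apply: (@le_trans _ _ (L / (2 * (1 + D1)) * (1 + D1))).
      by apply: ler_pM; rewrite ?(ltW t0)// ?lerDr//; apply: le_trans te _; rewrite ge_min lexx orbT.
    by rewrite invfM mulrA divfK// gt_eqF// ltr_pwDl.
  lra.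
have lamU : rnorm (lam x) <= C * (2 * rnorm (kvec H1 u)).
  apply: le_trans (rnorm_lam Xx) _; rewrite ler_wpM2l// -ktail0.
  apply: le_trans (ktail_scale 0 Xu t01) _; rewrite expr0 mul1r.
  exact: ktail_le.
have cE : rnorm (cdot (phi x) v) <= E * t.
  have Lb : 0 < b 1%N * (L / 2) by rewrite mulr_gt0// divr_gt0.
  rewrite /E mulrAC ler_pdivlMr//.
  apply: (@le_trans _ _ (rnorm (lam x) * b 1%N * rnorm (cdot (phi x) v))).
    by rewrite mulrC ler_wpM2r ?rnorm_ge0// mulrC ler_wpM2r// ltW.
  apply: le_trans (rnorm_cdot_phi Xx Xv) _.
  by rewrite -mulrA (mulrC D1); apply: ler_wpM2l => //; exact: rnorm_ge0.
have -> : \sum_(0 <= j < n) ((t ^+ j)%:C)%C *: c j =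
    lam x * rk_ev (kpart H2 n v) (phi x) - rk_dot H2 (kpart H2 n v) (S (ktail H1 n x)).
  rewrite -dot_S// -dotBr -linearB /ktail opprB addrC subrK linear_sum dot_sumr.
  apply: eq_bigr => j _; rewrite kpart_real linearZ dotZr.
  by rewrite (conjc_real _ : conj (_%:C)%C = (_%:C)%C).
apply: le_trans (rnormB _ _) _; rewrite mulrDl; apply: lerD.
  rewrite rnormM -[leRHS]mulrA.
  have evB : rnorm (rk_ev (kpart H2 n v) (phi x)) <= b n * E ^+ n * t ^+ n.
    rewrite ev_kpart//; last exact: domP.
    rewrite rnormM rnorm_real gtr0_norm// rnormX -mulrA -exprMn; apply: ler_wpM2l; first exact: ltW.
    by rewrite lerXn2r// nnegrE ?rnorm_ge0// (le_trans _ cE) ?rnorm_ge0.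
  by apply: ler_pM => //; exact: rnorm_ge0.
apply: le_trans (rnorm_dot_S _ _) _; rewrite -mulrA; apply: ler_wpM2l; first exact: rnorm_ge0.
rewrite -mulrA; apply: ler_wpM2l => //; rewrite mulrC; exact: ktail_scale.
Qed.

(** Test the image of the kernel vector at [x] against the degree [n] part of the
kernel vector at [phi x]; by [dot_S_lower] only the tail of degrees at least [n]
is seen. *)
Lemma coef_tail_bound n x : dom H1 x ->
  rnorm (lam x) ^+ 2 * (b n * enorm (phi x) ^+ (2 * n)) <= C ^+ 2 * rnorm (ktail H1 n x) ^+ 2.
Proof.
move=> Xx; have Xv := domP Xx; set v := phi x in Xv *.
have q0 := sqr_ge0 (rnorm (kpart H2 n v)); have qE := rnorm_kpart n Xv.
have := rnorm_dot_S (kpart H2 n v) (ktail H1 n x).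
have -> : rk_dot H2 (kpart H2 n v) (S (ktail H1 n x)) =
    lam x * ((rnorm (kpart H2 n v) ^+ 2)%:C)%C.
  rewrite /ktail linearB dotBr dot_S// linear_sum dot_sumr big_nat big1 ?subr0.
    by rewrite -/v (rk_evE _ Xv) dot_kpart_kvec// -(dotff (@rk_normE _ _ _ H2)).
  by move=> k /andP[_ kn]; exact: dot_S_lower.
rewrite rnormM rnorm_real ger0_norm// -qE.
set q := rnorm (kpart H2 n v); set T := rnorm (ktail H1 n x) => h.
have [->|qn0] := eqVneq q 0.
  by rewrite expr0n mulr0 mulr_ge0 ?sqr_ge0.
have qp : 0 < q by rewrite lt_neqAle eq_sym qn0 rnorm_ge0.
rewrite -!exprMn lerXn2r ?nnegrE ?mulr_ge0 ?rnorm_ge0//.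
by rewrite -(ler_pM2l qp) mulrCA -expr2.
Qed.

End FixedOrigin.

Section EqualRadius.
Variables (R : realType) (d : nat).
Local Notation conj := Num.conj.
Local Notation dom H := (natural_domain d (wh_coef H)).

(** Comparison with a geometric series. *)
Lemma conv_radius_ge (b : nat -> R) (t s D : R) :
  (forall n, 0 <= b n) -> 0 <= t < s -> (forall n, b n * s ^+ n <= D) ->
  (t%:E <= conv_radius b)%E.
Proof.
move=> b0 /andP[t0 ts] bD; have s0 : 0 < s by exact: le_lt_trans ts.
apply: ereal_sup_ubound; exists t => //; split => //.
apply: (@series_le_cvg _ _ (geometric D (t / s))) => [n|n|n|].
- by rewrite mulr_ge0// exprn_ge0.
- have D0 : 0 <= D by apply: le_trans (bD 0%N); rewrite expr0 mulr1.
  by rewrite /geometric /= mulr_ge0// exprn_ge0// divr_ge0// ltW.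
- rewrite /geometric /= expr_div_n mulrA ler_pdivlMr ?exprn_gt0//.
  by rewrite mulrAC ler_wpM2r// exprn_ge0.
- apply: is_cvg_geometric_series.
  by rewrite ger0_norm ?divr_ge0 ?(ltW s0)// ltr_pdivrMr// mul1r.
Qed.

Variable r : R.
Hypothesis r0 : 0 < r.

Lemma dom_enorm_le (H : weighted_hardy R d) x : has_radius H r -> dom H x -> enorm x <= r.
Proof.
rewrite /has_radius /natural_domain => ->.
by case: ifP => _ /=; rewrite sqrtr_sqr gtr0_norm// => /ltW.
Qed.

Lemma dom_of_enorm_lt (H : weighted_hardy R d) x : has_radius H r -> enorm x < r -> dom H x.
Proof.
rewrite /has_radius /natural_domain => ->.
by case: ifP => _ /=; rewrite sqrtr_sqr gtr0_norm// => /ltW.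
Qed.

(** If [|x| < |phi x|], choose [rho] with [|x| r / |phi x| < rho < r].  The tails at
[x] decay like [(|x| / rho)^n], so [coef_tail_bound] bounds
[b_n (|phi x| rho / |x|)^(2 n)], whereas [|phi x| rho / |x| > r]
contradicts the radius of convergence of the second generating function. *)
Lemma schwarz (H1 H2 : weighted_hardy R d) C lam phi :
  has_radius H1 r -> has_radius H2 r -> kernel_map H1 H2 C lam phi ->
  phi 0 = 0 -> lam 0 != 0 ->
  forall x, enorm x < r -> lam x != 0 -> enorm (phi x) <= enorm x.
Proof.
move=> r1 r2 [C0 domP [S [SC Sk]]] phi0 lam0 x xr lamx.
have Xx := dom_of_enorm_lt r1 xr.
rewrite leNgt; apply/negP => xy; set y := enorm (phi x) in xy.
have yr : y <= r by apply: dom_enorm_le r2 _; exact: domP.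
have x0 : 0 < enorm x.
  rewrite lt_neqAle eq_sym enorm_ge0 andbT; apply/eqP => /enorm_eq0 x0.
  by move: xy; rewrite /y x0 phi0 ltxx.
have y0 : 0 < y by exact: lt_trans xy.
pose rho := (enorm x * r / y + r) / 2.
have xry : enorm x * r / y < r by rewrite ltr_pdivrMr// mulrC ltr_pM2l.
have rho1 : enorm x * r / y < rho by rewrite /rho; lra.
have rho2 : rho < r by rewrite /rho; lra.
have rhox : enorm x <= rho.
  by apply: le_trans (ltW rho1); rewrite ler_pdivlMr// ler_pM2l.
have rho0 : 0 < rho by exact: lt_le_trans rhox.
pose t := enorm x / rho.
have t0 : 0 < t by rewrite divr_gt0.
have t01 : 0 <= t <= 1 by rewrite ltW//= ler_pdivrMr// mul1r.
(* The point of norm [rho] on the ray of [x]. *)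
pose x' := ((t^-1)%:C)%C *: x.
have x'E : (t%:C)%C *: x' = x by rewrite scalerA -rmorphM divff ?scale1r// gt_eqF.
have Xx' : dom H1 x'.
  apply: dom_of_enorm_lt r1 _; rewrite enormZ rnorm_real gtr0_norm ?invr_gt0//.
  by rewrite /t invf_div divfK// gt_eqF.
have lam2 : 0 < rnorm (lam x) ^+ 2.
  by rewrite exprn_gt0// lt_neqAle eq_sym rnorm_ge0 andbT; apply: contra_neq lamx => /rnorm_eq0.
pose D := C ^+ 2 * (2 * rnorm (kvec H1 x')) ^+ 2 / rnorm (lam x) ^+ 2.
pose s := (y / t) ^+ 2.
have bD n : wh_coef H2 n * s ^+ n <= D.
  rewrite /D ler_pdivlMr// mulrC.
  have := coef_tail_bound C0 domP SC Sk phi0 lam0 n Xx; rewrite -/y.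
  have tl : rnorm (ktail H1 n x) ^+ 2 <= t ^+ (2 * n) * (2 * rnorm (kvec H1 x')) ^+ 2.
    rewrite mulnC exprM -exprMn lerXn2r ?nnegrE ?mulr_ge0 ?exprn_ge0 ?rnorm_ge0 ?(ltW t0)//.
    rewrite -{1}x'E; apply: le_trans (ktail_scale n Xx' t01) _.
    by rewrite ler_wpM2l ?exprn_ge0 ?(ltW t0)// ktail_le.
  move=> /le_trans/(_ (ler_wpM2l (sqr_ge0 C) tl)) h.
  rewrite -exprM expr_div_n -(@ler_pM2l _ (t ^+ (2 * n))) ?exprn_gt0//.
  rewrite [leRHS]mulrCA; apply: le_trans h; rewrite le_eqVlt; apply/orP; left.
  have tn : t ^+ (2 * n) != 0 by rewrite gt_eqF// exprn_gt0.
  by apply/eqP; field.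
have sr : r ^+ 2 < s.
  rewrite /s ltrXn2r// ?nnegrE ?divr_ge0 ?ltW//.
  rewrite /t invf_div mulrA ltr_pdivlMr// mulrC.
  by move: rho1; rewrite ltr_pdivrMr// (mulrC rho).
have s2 : 0 <= (r ^+ 2 + s) / 2 < s.
  by have := sqr_ge0 r; move: sr; move: (r ^+ 2) => q; lra.
have := conv_radius_ge (fun n => ltW (wh_coef_gt0 H2 n)) s2 bD.
by rewrite r2 lee_fin; lra.
Qed.

(** In [coef_tail_bound] at [t u] both sides have order [t^(2 n)], as [phi]
preserves norms; comparing leading terms as [t] tends to 0 gives the claim. *)
Lemma coef_le (H1 H2 : weighted_hardy R d) C lam phi : (0 < d)%N ->
  has_radius H1 r -> kernel_map H1 H2 C lam phi ->
  phi 0 = 0 -> lam 0 != 0 ->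
  (forall x, enorm x < r -> enorm (phi x) = enorm x) ->
  forall n, rnorm (lam 0) ^+ 2 * wh_coef H2 n <= C ^+ 2 * wh_coef H1 n.
Proof.
move=> d0 r1 [C0 domP [S [SC Sk]]] phi0 lam0 iso n.
pose w : CVec R d := delta_mx 0 (Ordinal d0).
have w0 : 0 < enorm w.
  rewrite lt_neqAle eq_sym enorm_ge0 andbT; apply/eqP => /enorm_eq0/rowP/(_ (Ordinal d0)).
  by rewrite !mxE !eqxx => /eqP; rewrite oner_eq0.
pose u := ((r / 2 / enorm w)%:C)%C *: w.
have uE : enorm u = r / 2.
  by rewrite enormZ rnorm_real gtr0_norm ?divr_gt0// divfK// gt_eqF.
have u0 : 0 < enorm u by rewrite uE divr_gt0.
have ur : enorm u < r by rewrite uE; lra.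
have Xu := dom_of_enorm_lt r1 ur.
pose al := Num.sqrt (wh_coef H1 n); pose be := Num.sqrt (wh_coef H2 n).
have alE : al ^+ 2 = wh_coef H1 n by rewrite sqr_sqrtr// ltW// wh_coef_gt0.
have beE : be ^+ 2 = wh_coef H2 n by rewrite sqr_sqrtr// ltW// wh_coef_gt0.
have al0 : 0 <= al by exact: sqrtr_ge0.
have be0 : 0 <= be by exact: sqrtr_ge0.
rewrite -alE -beE -!exprMn lerXn2r ?nnegrE ?mulr_ge0 ?rnorm_ge0//.
rewrite -(@ler_pM2r _ (enorm u ^+ n)) ?exprn_gt0//.
pose K := C * rnorm (ktail H1 1 u) * (be * enorm u ^+ n) + C * rnorm (ktail H1 n.+1 u).
have un0 : 0 <= enorm u ^+ n by rewrite exprn_ge0// enorm_ge0.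
have K0 : 0 <= K by rewrite addr_ge0// !mulr_ge0 ?rnorm_ge0.
have main t : 0 < t -> t <= 1 ->
    rnorm (lam 0) * be * enorm u ^+ n <= C * al * enorm u ^+ n + t * K.
  move=> t0 t1; have t01 : 0 <= t <= 1 by rewrite ltW.
  pose x := (t%:C)%C *: u.
  have xE : enorm x = t * enorm u by rewrite enormZ rnorm_real gtr0_norm.
  have xr : enorm x < r.
    by rewrite xE; apply: le_lt_trans ur; rewrite ler_piMl// ltW.
  have Xx := dom_of_enorm_lt r1 xr.
  have tn0 : 0 < t ^+ n by rewrite exprn_gt0.
  have h1 : rnorm (lam x) * (be * (t ^+ n * enorm u ^+ n)) <= C * rnorm (ktail H1 n x).
    have := coef_tail_bound C0 domP SC Sk phi0 lam0 n Xx.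
    rewrite iso// xE mulnC exprM -beE -!exprMn ler_pXn2r//.
      by rewrite nnegrE exprMn !mulr_ge0 ?rnorm_ge0// ltW.
    by rewrite nnegrE mulr_ge0 ?rnorm_ge0.
  have h2 : rnorm (ktail H1 n x) <= t ^+ n * (al * enorm u ^+ n + t * rnorm (ktail H1 n.+1 u)).
    rewrite ktailS; apply: le_trans (rnormD _ _) _; rewrite mulrDr; apply: lerD.
      rewrite kpart_real rnormZ rnorm_real ger0_norm ?(ltW tn0)//.
      rewrite (_ : rnorm _ = al * enorm u ^+ n)//.
      apply/eqP; rewrite -(@eqrXn2 _ 2) ?rnorm_ge0 ?mulr_ge0// rnorm_kpart// exprMn alE.
      by rewrite -exprM mulnC.
    have := ktail_scale n.+1 Xu t01; rewrite exprSr -mulrA; exact.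
  have h3 : rnorm (lam 0) <= rnorm (lam x) + t * (C * rnorm (ktail H1 1 u)).
    have := rnormB (lam x) (lam x - lam 0); rewrite opprB addrC subrK => h.
    apply: le_trans h _; rewrite lerD2l.
    apply: (le_trans (rnorm_lam_dist domP SC Sk Xx)).
    rewrite (mulrCA t C).
    apply: (ler_wpM2l C0).
    have := ktail_scale 1 Xu t01.
    by rewrite expr1.
  have h4 : rnorm (lam x) * (be * enorm u ^+ n) <=
      C * (al * enorm u ^+ n + t * rnorm (ktail H1 n.+1 u)).
    rewrite -(ler_pM2l tn0).
    have := le_trans h1 (ler_wpM2l C0 h2).
    by rewrite [X in _ <= X -> _]mulrCA; apply: le_trans; rewrite le_eqVlt; apply/orP; left; apply/eqP; ring.
  have h5 := ler_wpM2r (mulr_ge0 be0 un0) h3.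
  rewrite -mulrA; apply: (le_trans h5); rewrite mulrDl.
  apply: (le_trans (lerD h4 (lexx _))).
  by rewrite le_eqVlt; apply/orP; left; apply/eqP; rewrite /K; ring.
apply/ler_addgt0Pr => e e0.
pose t := Num.min 1 (e / (1 + K)).
have K1 : 0 < 1 + K by rewrite ltr_pwDl.
have t0 : 0 < t by rewrite lt_min ltr01 divr_gt0.
apply: le_trans (main t t0 _) _; first by rewrite ge_min lexx.
rewrite lerD2l; apply: (@le_trans _ _ (e / (1 + K) * (1 + K))).
  apply: ler_pM => //; [exact: ltW | by rewrite ge_min lexx orbT | by rewrite lerDr].
by rewrite divfK ?gt_eqF.
Qed.

(** The Schwarz lemma for the map and for its inverse shows that both preserve norms;
the weights at the origin cancel in the product of the two instances of
[coef_le]. *)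
Lemma fixed_origin_coefs (H1 H2 : weighted_hardy R d) C C' lam phi lam' phi' :
  (0 < d)%N -> has_radius H1 r -> has_radius H2 r ->
  kernel_iso H1 H2 C C' lam phi lam' phi' -> phi 0 = 0 ->
  forall n k, wh_coef H2 n * wh_coef H1 k <=
    (C * C') ^+ 2 * (wh_coef H1 n * wh_coef H2 k).
Proof.
move=> d0 r1 r2 [m m' i i'] phi0 n k.
have phi'0 : phi' 0 = 0 by rewrite -{1}phi0; have [] := i 0 (natural_domain_origin H1).
have lamn0 x : dom H1 x -> lam x != 0.
  move=> /i[_ e]; apply/eqP => h; move/eqP: e; rewrite h mul0r eq_sym.
  by rewrite oner_eq0.
have lam'n0 x : dom H2 x -> lam' x != 0.
  move=> /i'[_ e]; apply/eqP => h; move/eqP: e; rewrite h mul0r eq_sym.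
  by rewrite oner_eq0.
have s1 x : enorm x < r -> enorm (phi x) <= enorm x.
  move=> xr; apply: (schwarz r1 r2 m) => //; first exact/lamn0/natural_domain_origin.
  exact/lamn0/(dom_of_enorm_lt r1).
have s2 x : enorm x < r -> enorm (phi' x) <= enorm x.
  move=> xr; apply: (schwarz r2 r1 m') => //; first exact/lam'n0/natural_domain_origin.
  exact/lam'n0/(dom_of_enorm_lt r2).
have iso1 x : enorm x < r -> enorm (phi x) = enorm x.
  move=> xr; apply/eqP; rewrite eq_le s1//=.
  have [e _] := i x (dom_of_enorm_lt r1 xr); rewrite -{1}e; apply: s2.
  exact: le_lt_trans (s1 _ xr) xr.
have iso2 x : enorm x < r -> enorm (phi' x) = enorm x.
  move=> xr; apply/eqP; rewrite eq_le s2//=.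
  have [e _] := i' x (dom_of_enorm_lt r2 xr); rewrite -{1}e; apply: s1.
  exact: le_lt_trans (s2 _ xr) xr.
have h1 := coef_le d0 r1 m phi0 (lamn0 _ (natural_domain_origin H1)) iso1 n.
have h2 := coef_le d0 r2 m' phi'0 (lam'n0 _ (natural_domain_origin H2)) iso2 k.
have [_ ll] := i 0 (natural_domain_origin H1); rewrite phi0 in ll.
have l1 : rnorm (lam 0) ^+ 2 * rnorm (lam' 0) ^+ 2 = 1.
  by rewrite -exprMn -rnormM ll -(rmorph1 (real_complex R)) rnorm_real normr1 expr1n.
have p0 (H : weighted_hardy R d) j : 0 <= wh_coef H j by rewrite ltW// wh_coef_gt0.
have := ler_pM (mulr_ge0 (sqr_ge0 _) (p0 _ _)) (mulr_ge0 (sqr_ge0 _) (p0 _ _)) h1 h2.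
by rewrite mulrACA l1 mul1r mulrACA -exprMn.
Qed.

End EqualRadius.

(** * Points and roots of unity on the unit circle *)

Section Circle.
Variable R : realType.
Local Notation conj := Num.conj.

Definition expi (x : R) : Cplx R := (cos x +i* sin x)%C.

Lemma expiD x y : expi (x + y) = expi x * expi y.
Proof.
by apply/eqP; rewrite eq_complex /= cosD sinD eqxx /= addrC.
Qed.

Lemma expi0 : expi 0 = 1.
Proof. by rewrite /expi cos0 sin0. Qed.

Lemma expiX x n : expi x ^+ n = expi (x *+ n).
Proof.
elim: n => [|n IH]; first by rewrite expr0 mulr0n expi0.
by rewrite exprS IH mulrS expiD.
Qed.

Lemma expi2pi : expi (pi *+ 2) = 1.
Proof. by rewrite /expi cos2pi sin2pi. Qed.

Lemma rnorm_expi x : rnorm (expi x) = 1.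
Proof.
apply/eqP; rewrite -(@eqrXn2 _ 2) ?rnorm_ge0// expr1n; apply/eqP/(@complexI R).
rewrite -rnorm_mulJ /expi; apply/eqP; rewrite eq_complex /=.
rewrite mulrN opprK -!expr2 cos2Dsin2 eqxx /=.
by rewrite mulrN addrC mulrC subrr.
Qed.

Lemma expi_conj x : conj (expi x) * expi x = 1.
Proof. by rewrite mulrC rnorm_mulJ rnorm_expi expr1n. Qed.

Lemma expi_neq1 x : 0 < x < pi *+ 2 -> expi x != 1.
Proof.
move=> /andP[x0 x2]; apply/eqP => -[c1 _].
have : 0 < sin (x / 2) ^+ 2.
  rewrite exprn_gt0// sin_gt0_pi// divr_gt0//= ltr_pdivrMr//.
  by rewrite mulr_natr.
have := cos2Dsin2 (x / 2); have := cos_mulr2n (x / 2).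
rewrite (_ : x / 2 *+ 2 = x); last by rewrite -mulr_natr divfK.
by rewrite c1 mulr2n; lra.
Qed.

Lemma rnorm_expi_dist x y : rnorm (expi x - expi y) <= `|cos x - cos y| + `|sin x - sin y|.
Proof.
have -> : expi x - expi y = ((cos x - cos y)%:C)%C + 'i%C * ((sin x - sin y)%:C)%C :> R[i].
  by apply/eqP; rewrite eq_complex /=; apply/andP; split; apply/eqP; ring.
apply: le_trans (rnormD _ _) _; rewrite rnorm_real lerD2l.
rewrite (rnormM 'i%C) rnorm_real (_ : rnorm _ = 1) ?mul1r//.
by rewrite /rnorm normc_def /= expr0n expr1n /= add0r sqrtr1.
Qed.

Lemma rnorm_powers_dist (c e : Cplx R) n : rnorm c <= 1 -> rnorm e <= 1 ->
  rnorm (c ^+ n - e ^+ n : Cplx R) <= n%:R * rnorm (c - e).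
Proof.
move=> c1 e1; elim: n => [|n IH]; first by rewrite !expr0 subrr rnorm0 mul0r.
have -> : c ^+ n.+1 - e ^+ n.+1 = c * (c ^+ n - e ^+ n) + (c - e) * e ^+ n.
  by rewrite !exprS; ring.
apply: le_trans (rnormD _ _) _; rewrite !rnormM rnormX -natr1 mulrDl mul1r; apply: lerD.
  by apply: le_trans IH; rewrite ler_piMl ?rnorm_ge0.
by rewrite ler_piMr ?rnorm_ge0// exprn_ile1 ?rnorm_ge0.
Qed.

(** A geometric sum whose ratio is an [N]-th root of unity other than 1. *)
Lemma root_sum (N k : nat) : (0 < k < N)%N ->
  \sum_(j < N) conj (expi (pi *+ 2 / N%:R) ^+ j) ^+ k = 0 :> Cplx R.
Proof.
move=> /andP[k0 kN]; have N0 : (0 < N)%N by exact: leq_ltn_trans kN.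
set w := expi _; pose z : Cplx R := conj (w ^+ k).
have NR : 0 < N%:R :> R by rewrite ltr0n.
have z1 : z != 1.
  rewrite -(rmorph1 (Num.conj : {rmorphism R[i] -> R[i]})).
  apply: contra_neq (_ : w ^+ k != 1); first exact: (can_inj (@conjCK _)).
  rewrite /w expiX; apply: expi_neq1; rewrite -mulrnAl -mulr_natr.
  have p0 : 0 < pi *+ 2 :> R by rewrite mulrn_wgt0 ?pi_gt0.
  rewrite divr_gt0 ?mulr_gt0 ?ltr0n//= ltr_pdivrMr// ltr_pM2l//.
  by rewrite ltr_nat.
have wN : w ^+ N = 1.
  by rewrite /w expiX -[_ *+ N]mulr_natr divfK ?gt_eqF// expi2pi.
have zN : z ^+ N = 1.
  by rewrite /z -rmorphXn -exprM mulnC exprM wN expr1n rmorph1.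
have : (z - 1) * \sum_(j < N) z ^+ j = 0 by rewrite -subrX1 zN subrr.
move/eqP; rewrite mulf_eq0 subr_eq0 (negPf z1) /= => /eqP h.
rewrite -[RHS]h; apply: eq_bigr => j _.
by rewrite /z -!rmorphXn -!exprM mulnC.
Qed.

End Circle.

(** * Kernel vectors along a circle *)

Section CircleInHardySpace.
Variables (R : realType) (d : nat).
Local Notation conj := Num.conj.
Local Notation dom H := (natural_domain d (wh_coef H)).

Variable H : weighted_hardy R d.
Variable q : CVec R d.
Hypothesis Xq : dom H q.
Let dotE := @rk_normE R _ _ H.

Lemma dom_circle (c : Cplx R) : rnorm c <= 1 -> dom H (c *: q).
Proof. by move=> c1; exact: natural_domainZ Xq _. Qed.

Lemma kvec_circle (c : Cplx R) : rnorm c <= 1 ->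
  norm_cvg (fun N => \sum_(0 <= k < N) (conj c ^+ k) *: kpart H k q) (kvec H (c *: q)).
Proof.
move=> c1; have := kvec_sum (dom_circle c1); congr norm_cvg; apply/funext => N.
by apply: eq_bigr => k _; rewrite kpartZ.
Qed.

Lemma multiplier_ktail (c : nat -> Cplx R) (m : H) N (M : R) :
  norm_cvg (fun n => \sum_(0 <= k < n) c k *: kpart H k q) m ->
  (forall k, (N <= k)%N -> rnorm (c k) <= M) ->
  rnorm (m - \sum_(0 <= k < N) c k *: kpart H k q) <= M * rnorm (ktail H N q).
Proof.
apply: (rnorm_multiplier_tail dotE _ (kvec_sum Xq)).
by move=> k j kj; exact: dot_kpart_orth.
Qed.

Lemma rnorm_kvec_circle (c : Cplx R) : rnorm c <= 1 -> rnorm (kvec H (c *: q)) <= rnorm (kvec H q).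
Proof.
move=> c1; have := @multiplier_ktail _ _ 0 1 (kvec_circle c1).
rewrite big_geq// subr0 ktail0 mul1r; apply => k _.
by rewrite rnormX rnorm_conj exprn_ile1 ?rnorm_ge0.
Qed.

(** The first [N] multipliers are estimated one by one and the others by 2, which
is uniform in the two points and valid also on the boundary sphere, where no
larger point of the domain is available for comparison. *)
Lemma kvec_circle_dist (c e : Cplx R) N : rnorm c <= 1 -> rnorm e <= 1 ->
  rnorm (kvec H (c *: q) - kvec H (e *: q)) <=
    rnorm (c - e) * \sum_(0 <= k < N) k%:R * rnorm (kpart H k q) + 2 * rnorm (ktail H N q).
Proof.
move=> c1 e1.
have ce : norm_cvg (fun n => \sum_(0 <= k < n) (conj c ^+ k - conj e ^+ k) *: kpart H k q)
    (kvec H (c *: q) - kvec H (e *: q)).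
  have := norm_cvg_linear (-1) (kvec_circle e1) (kvec_circle c1).
  rewrite scaleN1r addrC; congr norm_cvg; apply/funext => n.
  by rewrite scaleN1r addrC -sumrB; apply: eq_bigr => k _; rewrite scalerBl.
set m := _ - _ in ce *.
have pw (z : Cplx R) k : rnorm z <= 1 -> rnorm (conj z ^+ k : Cplx R) <= 1.
  by move=> z1; rewrite rnormX rnorm_conj exprn_ile1 ?rnorm_ge0.
have h := @multiplier_ktail _ _ N 2 ce.
set s := \sum_(0 <= k < N) (_ - _) *: _ in h.
have hs : rnorm s <= rnorm (c - e) * \sum_(0 <= k < N) k%:R * rnorm (kpart H k q).
  apply: le_trans (rnorm_sum _ _ _) _; rewrite mulr_sumr; apply: ler_sum => k _.
  rewrite rnormZ mulrA; apply: ler_wpM2r; first exact: rnorm_ge0.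
  apply: le_trans (rnorm_powers_dist k _ _) _; rewrite ?rnorm_conj//.
  by rewrite -rmorphB rnorm_conj mulrC.
rewrite -[m](subrK s) addrC; apply: le_trans (rnormD _ _) _; apply: lerD => //.
apply: h => k _; apply: le_trans (rnormB _ _) _.
by have := lerD (pw _ k c1) (pw _ k e1).
Qed.

Lemma kvec_circle_continuous (x : R) (eps : R) : 0 < eps ->
  \forall y \near x, rnorm (kvec H (expi x *: q) - kvec H (expi y *: q)) <= eps.
Proof.
move=> eps0.
have e4 : 0 < eps / 4 by rewrite divr_gt0.
have [N hN] := norm_cvg_near (kvec_sum Xq) e4.
have tailN : rnorm (ktail H N q) <= eps / 4 by rewrite /ktail rnorm_distC hN.
pose K := \sum_(0 <= k < N) k%:R * rnorm (kpart H k q).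
have K0 : 0 <= K by rewrite sumr_ge0// => k _; rewrite mulr_ge0 ?rnorm_ge0.
pose de := eps / 4 / (1 + K).
have K1 : 0 < 1 + K by rewrite ltr_pwDl.
have de0 : 0 < de by rewrite divr_gt0.
have /cvgrPdist_le/(_ de de0) hc := @continuous_cos R x.
have /cvgrPdist_le/(_ de de0) hs := @continuous_sin R x.
apply: filterS2 hc hs => y cy sy.
have ce1 (z : R) : rnorm (expi z) <= 1 by rewrite rnorm_expi.
apply: le_trans (kvec_circle_dist N (ce1 x) (ce1 y)) _.
have h1 : rnorm (expi x - expi y) <= 2 * de.
  by apply: le_trans (rnorm_expi_dist _ _) _; rewrite mulr_natl mulr2n; exact: lerD.
have h2 : rnorm (expi x - expi y) * K <= 2 * (eps / 4).
  apply: (@le_trans _ _ (2 * de * (1 + K))).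
    by apply: ler_pM; rewrite ?rnorm_ge0// lerDr.
  by rewrite -mulrA divfK// gt_eqF.
have h3 : 2 * rnorm (ktail H N q) <= 2 * (eps / 4) by rewrite ler_pM2l.
apply: (le_trans (lerD h2 h3)).
by rewrite (_ : _ + _ = eps)//; field.
Qed.

(** Mean value property: averaging over the [N]-th roots of unity removes all
degrees that are not multiples of [N], which leaves the constant part and a
portion of the tail. *)
Lemma circle_average (eps : R) : 0 < eps -> exists2 N, (0 < N)%N &
  rnorm (kvec H 0 - ((N%:R^-1)%:C)%C *:
    \sum_(j < N) kvec H (expi (pi *+ 2 / N%:R) ^+ j *: q)) <= eps.
Proof.
move=> eps0.
have [M hM] := norm_cvg_near (kvec_sum Xq) eps0.
exists M.+1 => //; set N := M.+1.
have N0 : 0 < N%:R :> R by rewrite ltr0n.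
have tailN : rnorm (ktail H N q) <= eps by rewrite /ktail rnorm_distC hM.
set w := expi _.
have w1 j : rnorm (w ^+ j : Cplx R) <= 1 by rewrite rnormX rnorm_expi expr1n.
pose c k : Cplx R := ((N%:R^-1)%:C)%C * \sum_(j < N) conj (w ^+ j) ^+ k.
set m := _ *: _.
have cm : norm_cvg (fun n => \sum_(0 <= k < n) c k *: kpart H k q) m.
  have h := norm_cvg_sum (index_enum 'I_N) (fun=> 1) (fun j : 'I_N => kvec_circle (w1 j)).
  have := norm_cvg_linear ((N%:R^-1)%:C)%C h (norm_cvg_cst 0).
  rewrite addr0 (eq_bigr (fun j : 'I_N => kvec H (w ^+ j *: q))); last first.
    by move=> j _; rewrite scale1r.
  congr norm_cvg; apply/funext => n; rewrite addr0 /c.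
  rewrite (eq_bigr (fun j : 'I_N => \sum_(0 <= k < n) conj (w ^+ j) ^+ k *: kpart H k q)); last first.
    by move=> j _; rewrite scale1r.
  rewrite exchange_big scaler_sumr; apply: eq_bigr => k _.
  by rewrite -scaler_suml scalerA.
have c0 : c 0%N = 1.
  rewrite /c (eq_bigr (fun=> 1)) => [|j _]; last by rewrite expr0.
  rewrite sumr_const card_ord -(rmorph_nat (real_complex R)) -rmorphM mulVf ?rmorph1//.
  by rewrite gt_eqF.
have ck k : (0 < k < N)%N -> c k = 0.
  by move=> kN; rewrite /c root_sum// mulr0.
have c1 k : rnorm (c k) <= 1.
  rewrite /c rnormM rnorm_real gtr0_norm ?invr_gt0// mulrC ler_pdivrMr// mul1r.
  apply: le_trans (rnorm_sum _ _ _) _.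
  apply: (@le_trans _ _ (\sum_(j < N) 1)).
    apply: ler_sum => j _; rewrite rnormX rnorm_conj exprn_ile1 ?rnorm_ge0//.
  by rewrite sumr_const card_ord.
have := @multiplier_ktail _ _ N 1 cm (fun k _ => c1 k).
rewrite mul1r big_ltn// big_nat big1 ?addr0; last first.
  by move=> k kN; rewrite ck// scale0r.
rewrite c0 scale1r kpart0 -kvec0 rnorm_distC => h; exact: le_trans h tailN.
Qed.

End CircleInHardySpace.

(** * Moving the origin back to itself *)

Section MovingOrigin.
Variables (R : realType) (d : nat).
Local Notation conj := Num.conj.
Local Notation dom H := (natural_domain d (wh_coef H)).

Lemma ev_coordinate (H : weighted_hardy R d) (i : 'I_d) z : dom H z ->
  rk_ev (wh_monomial H [ffun j => (j == i : nat)]) z = z 0 i.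
Proof.
move=> Xz; rewrite wh_monomialE// /monomial (bigD1 i)//= ffunE eqxx expr1.
by rewrite big1 ?mulr1// => j ji; rewrite ffunE (negPf ji) expr0.
Qed.

Section OneMap.
Variables (H1 H2 : weighted_hardy R d) (C : R).
Variables (lam : CVec R d -> Cplx R) (phi : CVec R d -> CVec R d).
Variable S : {linear H1 -> H2}.
Hypothesis C0 : 0 <= C.
Hypothesis domP : forall x, dom H1 x -> dom H2 (phi x).
Hypothesis SC : forall f, rnorm (S f) <= C * rnorm f.
Hypothesis Sk : forall x, dom H1 x -> S (kvec H1 x) = conj (lam x) *: kvec H2 (phi x).
Hypothesis lam_neq0 : forall x, dom H1 x -> lam x != 0.
Variable q : CVec R d.
Hypothesis Xq : dom H1 q.

Let Xc x : dom H1 (expi x *: q).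
Proof. by apply: dom_circle; rewrite ?rnorm_expi. Qed.

Lemma dot_S_continuous (f : H2) :
  continuous (fun x => rnorm (rk_dot H2 f (S (kvec H1 (expi x *: q))) : Cplx R)).
Proof.
move=> x; apply/cvgrPdist_le => eps eps0.
pose K := 1 + rnorm f * C.
have K0 : 0 < K by rewrite ltr_pwDl// mulr_ge0 ?rnorm_ge0.
have e1 : 0 < eps / K by rewrite divr_gt0.
apply: filterS (kvec_circle_continuous Xq x e1) => y yh.
apply: le_trans (rnorm_dist _ _) _; rewrite -dotBr -linearB.
apply: (le_trans (rnorm_dot_S SC _ _)); rewrite mulrA.
apply: (@le_trans _ _ (K * (eps / K))).
  by apply: ler_pM => //; rewrite ?mulr_ge0 ?rnorm_ge0// lerDr.
by rewrite mulrC divfK// gt_eqF.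
Qed.

(** Each coordinate of [phi] is a quotient of two images under the adjoint of [S], of a
coordinate function and of the constant 1. *)
Lemma enorm_phi_continuous : continuous (fun x => enorm (phi (expi x *: q)) ^+ 2).
Proof.
pose num (i : 'I_d) x := rnorm (rk_dot H2 (wh_monomial H2 [ffun j => (j == i : nat)])
  (S (kvec H1 (expi x *: q))) : Cplx R).
pose den x := rnorm (rk_dot H2 (kpart H2 0 0) (S (kvec H1 (expi x *: q))) : Cplx R).
have denE x : den x = rnorm (lam (expi x *: q)) by rewrite /den -(lamE domP Sk (Xc x)).
have den0 x : den x != 0.
  by rewrite denE; apply: contra_neq (lam_neq0 (Xc x)) => /rnorm_eq0.
have E x : enorm (phi (expi x *: q)) ^+ 2 =
    \sum_(i <- index_enum 'I_d) (num i x / den x) * (num i x / den x).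
  rewrite enorm_sqr; apply: eq_bigr => i _.
  rewrite -expr2; congr (_ ^+ 2); apply: (mulIf (den0 x)); rewrite divfK//.
  by rewrite /num (dot_S domP Sk _ (Xc x)) ev_coordinate ?rnormM ?denE 1?mulrC//; exact: domP.
rewrite (funext E); elim: (index_enum _) => [|i s IH].
  rewrite (_ : (fun x => _) = (fun=> 0)); first by move=> x; exact: cvg_cst.
  by apply/funext => x; rewrite big_nil.
rewrite (_ : (fun x => _) = (fun x => num i x / den x * (num i x / den x) +
  \sum_(j <- s) num j x / den x * (num j x / den x))).
  move=> x; apply: cvgD (IH x).
  have h : (num i y / den y) @[y --> x] --> num i x / den x.
    by apply: cvgM; [exact: dot_S_continuous | apply: cvgV => //; exact: dot_S_continuous].
  exact: (cvgM h h).
by apply/funext => x; rewrite big_cons.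
Qed.

(** The mean value property applied to the image of [<., p>^n] under the adjoint,
where [p = phi 0], gives [|lam 0| |p|^n <= L mu^n] with [L] independent of [n]
and [mu] the maximum of [|phi|] on the circle.  For large [n] this excludes
[mu < |p|].  Taking powers disposes of the weight [lam]. *)
Lemma circle_maximum : exists2 x, 0 <= x <= pi *+ 2 &
  enorm (phi 0) <= enorm (phi (expi x *: q)).
Proof.
have p0 : 0 <= pi *+ 2 :> R by rewrite mulrn_wge0// pi_ge0.
have [x xI xmax] := EVT_max p0 (continuous_subspaceT enorm_phi_continuous).
exists x; first by move: xI; rewrite in_itv.
rewrite leNgt; apply/negP => lt_p.
set mu := enorm (phi (expi x *: q)) in lt_p xmax; pose p := phi 0.
have mu0 : 0 <= mu by exact: enorm_ge0.
have pp : 0 < enorm p by exact: le_lt_trans lt_p.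
have Xp : dom H2 p by apply: domP; exact: natural_domain_origin.
have mu_max y : 0 <= y <= pi *+ 2 -> enorm (phi (expi y *: q)) <= mu.
  move=> yI; have yI' : y \in `[0, pi *+ 2] by rewrite in_itv.
  have := xmax y yI'.
  by rewrite (ler_pXn2r (n := 2) isT (enorm_ge0 _ : _ \is Num.nneg) (mu0 : _ \is Num.nneg)).
clearbody mu.
pose L := C * rnorm (kvec H1 q).
have bound n : rnorm (lam 0) <= L * (mu / enorm p) ^+ n.
  pose f := kpart H2 n p; have bn := wh_coef_gt0 H2 n.
  pose B := L * (wh_coef H2 n * (mu * enorm p) ^+ n).
  have fB y : 0 <= y <= pi *+ 2 ->
      rnorm (rk_dot H2 f (S (kvec H1 (expi y *: q))) : Cplx R) <= B.
    move=> yI; rewrite (dot_S domP Sk _ (Xc y)) rnormM; apply: ler_pM; rewrite ?rnorm_ge0//.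
      apply: le_trans (rnorm_lam domP SC Sk (Xc y)) _.
      by rewrite ler_wpM2l// rnorm_kvec_circle// rnorm_expi.
    rewrite ev_kpart//; last exact: domP.
    rewrite rnormM rnorm_real gtr0_norm// rnormX; apply: ler_wpM2l; first exact: ltW.
    rewrite lerXn2r ?nnegrE ?rnorm_ge0 ?mulr_ge0 ?enorm_ge0//.
    apply: le_trans (rnorm_cdot _ _) _; apply: ler_wpM2r; first exact: enorm_ge0.
    exact: mu_max.
  have fB0 : rnorm (rk_dot H2 f (S (kvec H1 0)) : Cplx R) <= B.
    apply/ler_addgt0Pr => eps eps0.
    pose K := 1 + rnorm f * C.
    have K0 : 0 < K by rewrite ltr_pwDl// mulr_ge0 ?rnorm_ge0.
    have e1 : 0 < eps / K by rewrite divr_gt0.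
    have [N N0 hN] := circle_average Xq e1.
    set m := _ *: _ in hN.
    have NR : 0 < N%:R :> R by rewrite ltr0n.
    have mB : rnorm (rk_dot H2 f (S m) : Cplx R) <= B.
      rewrite /m linearZ dotZr (rnormM (conj _)) rnorm_conj rnorm_real gtr0_norm ?invr_gt0//.
      rewrite mulrC ler_pdivrMr// linear_sum dot_sumr.
      apply: le_trans (rnorm_sum _ _ _) _.
      apply: (@le_trans _ _ (\sum_(j < N) B)); last first.
        by rewrite sumr_const card_ord mulr_natr.
      apply: ler_sum => j _; rewrite expiX; apply: fB.
      rewrite mulrn_wge0 ?divr_ge0 ?(ltW NR)//= -[leLHS]mulr_natr mulrAC.
      by rewrite ler_pdivrMr// ler_wpM2l// ler_nat ltnW.
    rewrite -[kvec H1 0](subrK m) linearD dotDr; apply: le_trans (rnormD _ _) _.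
    rewrite addrC; apply: lerD => //.
    apply: (le_trans (rnorm_dot_S SC _ _)); rewrite mulrA.
    apply: (@le_trans _ _ (K * (eps / K))); last by rewrite mulrC divfK// gt_eqF.
    by apply: ler_pM => //; rewrite ?mulr_ge0 ?rnorm_ge0// lerDr.
  move: fB0; rewrite (dot_S domP Sk _ (natural_domain_origin H1)) ev_kpart// cdotff rnormM rnormM rnorm_real.
  rewrite gtr0_norm// rnormX rnorm_real ger0_norm ?sqr_ge0// /B expr2 !exprMn => h.
  rewrite exprVn [leRHS]mulrA ler_pdivlMr ?exprn_gt0//; move: h.
  move: (exprn_gt0 n pp) bn; move: (enorm p ^+ n) (wh_coef H2 n) (mu ^+ n) (rnorm (lam 0)).
  move=> P b Q l P0 b0 h; rewrite -(ler_pM2r (mulr_gt0 b0 P0)).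
  by move: h; rewrite -!mulrA (mulrCA P b) (mulrCA Q b).
have lam0 : 0 < rnorm (lam 0).
  by rewrite lt_neqAle eq_sym rnorm_ge0 andbT; apply: contra_neq (lam_neq0 (natural_domain_origin H1)) => /rnorm_eq0.
have ratio : `|mu / enorm p| < 1.
  by rewrite ger0_norm ?divr_ge0 ?enorm_ge0// ltr_pdivrMr// mul1r.
have cv : (fun n => L * (mu / enorm p) ^+ n) @ \oo --> L * 0.
  by apply: cvgM (cvg_expr ratio); exact: cvg_cst.
have : rnorm (lam 0) <= L * 0.
  by apply: ler_cvg_to (cvg_cst _) cv _; apply: nearW; exact: bound.
by rewrite mulr0 leNgt lam0.
Qed.

(** Intermediate value theorem between [q], where [phi] vanishes, and a point
provided by [circle_maximum]. *)
Lemma circle_level : phi q = 0 -> exists x, enorm (phi (expi x *: q)) = enorm (phi 0).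
Proof.
move=> phiq; have [x /andP[x0 x2] hx] := circle_maximum.
have gc := continuous_subspaceT enorm_phi_continuous.
have [|y _ gy] := @IVT R _ 0 x (enorm (phi 0) ^+ 2) x0 (gc _).
  rewrite expi0 scale1r phiq enorm0 expr0n ge_min le_max sqr_ge0 /=.
  by rewrite lerXn2r ?nnegrE ?enorm_ge0// orbT.
exists y; apply/eqP; rewrite -(@eqrXn2 _ 2) ?enorm_ge0//; exact/eqP.
Qed.

End OneMap.

Lemma recentred_kernel_iso (H1 H2 : weighted_hardy R d) C C' lam phi lam' phi' :
  kernel_iso H1 H2 C C' lam phi lam' phi' ->
  exists K K' mu psi mu' psi', [/\ kernel_iso H1 H2 K K' mu psi mu' psi',
    psi 0 = 0 & K * K' = (C * C') ^+ 3].
Proof.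
move=> T; have [[C0 domP [S [SC Sk]]] [C'0 domP' _] i i'] := T.
pose q := phi' 0; have Xq : dom H1 q by apply: domP'; exact: natural_domain_origin.
have phiq : phi q = 0 by have [] := i' 0 (natural_domain_origin H2).
have lam0 x : dom H1 x -> lam x != 0.
  move=> /i[_ e]; apply/eqP => h; move/eqP: e; rewrite h mul0r eq_sym.
  by rewrite oner_eq0.
have [x hx] := circle_level C0 domP SC Sk lam0 Xq phiq.
have [W [W' [Wp Wiso W'iso WK W'K]]] := unitary_transitive (esym hx).
pose rot (c : Cplx R) (z : CVec R d) := c *: z.
have rot_iso (c : Cplx R) : c * conj c = 1 -> forall y z, cdot (rot c y) (rot c z) = cdot y z.
  by move=> cc y z; rewrite /rot cdotZl cdotZr mulrA cc mul1r.
have cc : conj (expi x) * expi x = 1 by exact: expi_conj.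
have rotK : cancel (rot (conj (expi x))) (rot (expi x)).
  by move=> z; rewrite /rot scalerA mulrC cc scale1r.
have rotK' : cancel (rot (expi x)) (rot (conj (expi x))).
  by move=> z; rewrite /rot scalerA cc scale1r.
(* The two isometries and the two copies of [T] around [T^-1] send 0 to
   [phi 0], [phi (e^(i x) q)], [e^(i x) q], [q] and 0 in turn. *)
have TW := unitary_kernel_iso H2 Wiso W'iso WK W'K.
have TR := unitary_kernel_iso H1 (rot_iso (conj (expi x)) _) (rot_iso (expi x) _) rotK rotK'.
rewrite conjCK in TR; have {}TR := TR cc (etrans (mulrC _ _) cc).
have := kernel_iso_comp (kernel_iso_comp (kernel_iso_comp (kernel_iso_comp T TW)
  (kernel_iso_sym T)) TR) T.
move=> iso; do 6 eexists; split; first exact: iso.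
- have x1 : rnorm (expi x) <= 1 by rewrite rnorm_expi.
  rewrite /= Wp; have [-> _] := i _ (dom_circle Xq x1).
  by rewrite -/(rot (expi x) q) rotK'.
- by rewrite !mul1r !mulr1; ring.
Qed.

(** The exponent is 6 since the distortion is cubed by recentring and enters
[fixed_origin_coefs] squared. *)
Lemma kernel_iso_coefs (H1 H2 : weighted_hardy R d) (r : R) C C' lam phi lam' phi' :
  (0 < d)%N -> 0 < r -> has_radius H1 r -> has_radius H2 r ->
  kernel_iso H1 H2 C C' lam phi lam' phi' ->
  forall n k, wh_coef H2 n * wh_coef H1 k <=
    (C * C') ^+ 6 * (wh_coef H1 n * wh_coef H2 k).
Proof.
move=> d0 r0 r1 r2 /recentred_kernel_iso[K [K' [mu [psi [mu' [psi' [iso psi0 KK]]]]]]] n k.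
have := fixed_origin_coefs r0 d0 r1 r2 iso psi0 n k.
by rewrite KK -exprM.
Qed.

End MovingOrigin.

(** * The operator that matches kernel vectors at equal points *)

Section Inclusion.
Variables (R : realType) (d : nat).
Local Notation conj := Num.conj.
Local Notation dom H := (natural_domain d (wh_coef H)).

(** Both domains are balls of radius [r], and by comparison the second is closed if the
first is. *)
Lemma dom_sub (H1 H2 : weighted_hardy R d) (r B : R) :
  has_radius H1 r -> has_radius H2 r ->
  (forall n, wh_coef H2 n <= B * wh_coef H1 n) ->
  forall x, dom H1 x -> dom H2 x.
Proof.
rewrite /has_radius /natural_domain => -> -> ba x.
case: ifPn => [/asboolP cva|_]; case: ifPn => [_|/asboolP cvb] //=; last exact: ltW.
exfalso; apply: cvb.
have r2n n : 0 <= r ^+ 2 ^+ n by rewrite exprn_ge0 ?sqr_ge0.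
have br n : 0 <= wh_coef H2 n * r ^+ 2 ^+ n.
  by rewrite mulr_ge0//; apply/ltW/wh_coef_gt0.
have bar n : wh_coef H2 n * r ^+ 2 ^+ n <= B * (wh_coef H1 n * r ^+ 2 ^+ n).
  by rewrite mulrA ler_wpM2r.
apply: (@series_le_cvg _ _ (fun n => B * (wh_coef H1 n * r ^+ 2 ^+ n))) => //.
- by move=> n; exact: le_trans (br n) (bar n).
- rewrite (_ : series _ = (fun n => B * series (fun n => wh_coef H1 n * r ^+ 2 ^+ n) n)).
    by apply: is_cvgMr.
  by apply/funext => n; rewrite /series /= mulr_sumr.
Qed.

(** Gram matrices of kernel vectors split into their homogeneous parts, and in degree
[n] the two spaces differ by the factor [b_n / a_n] only. *)
Lemma inclusion_kernel_map (H1 H2 : weighted_hardy R d) (B : R) : 0 <= B ->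
  (forall n, wh_coef H2 n <= B * wh_coef H1 n) ->
  (forall x, dom H1 x -> dom H2 x) ->
  kernel_map H1 H2 (Num.sqrt B) (fun=> 1) id.
Proof.
move=> B0 ba sub; split=> //.
have [|s|T [Tk TC]] := @kernel_extension R d H1 H2 (kvec H2) (Num.sqrt B).
- exact: sqrtr_ge0.
- pose F (H : weighted_hardy R d) n : H := \sum_(p <- s) p.1 *: kpart H n (sval p.2).
  have Fsum (H : weighted_hardy R d) : (forall x, dom H1 x -> dom H x) ->
      norm_cvg (fun N => \sum_(0 <= n < N) F H n) (\sum_(p <- s) p.1 *: kvec H (sval p.2)).
    move=> subH; have := norm_cvg_sum s (fun p => p.1) (fun p => kvec_sum (subH _ (svalP p.2))).
    congr norm_cvg; apply/funext => N; rewrite exchange_big; apply: eq_bigr => p _.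
    by rewrite scaler_sumr.
  have Forth (H : weighted_hardy R d) k j : k != j -> rk_dot H (F H k) (F H j) = 0.
    move=> kj; rewrite /F dot_suml big1// => p _; rewrite dot_sumr big1// => p' _.
    by rewrite dotZl dotZr dot_kpart_orth// !mulr0.
  pose Q n : Cplx R := \sum_(p <- s) \sum_(p' <- s)
    p.1 * conj p'.1 * cdot (sval p'.2) (sval p.2) ^+ n.
  have FQ (H : weighted_hardy R d) n : (forall x, dom H1 x -> dom H x) ->
      ((rnorm (F H n) ^+ 2)%:C)%C = (wh_coef H n)%:C%C * Q n.
    move=> subH; rewrite -(dotff (@rk_normE _ _ _ H)) /F dot_suml mulr_sumr.
    apply: eq_bigr => p _; rewrite dot_sumr mulr_sumr; apply: eq_bigr => p' _.
    rewrite dotZl dotZr dot_kpart; try exact: subH (svalP _).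
    by ring.
  have F12 n : rnorm (F H2 n) ^+ 2 <= B * rnorm (F H1 n) ^+ 2.
    have a0 := wh_coef_gt0 H1 n.
    have E : rnorm (F H2 n) ^+ 2 * wh_coef H1 n = wh_coef H2 n * rnorm (F H1 n) ^+ 2.
      apply: (@complexI R); rewrite [LHS]rmorphM [RHS]rmorphM /=.
      rewrite (FQ H2 n sub) (FQ H1 n (fun x => id)); ring.
    rewrite -(ler_pM2r a0) E mulrAC; apply: ler_wpM2r => //; exact: sqr_ge0.
  have part N : rnorm (\sum_(0 <= n < N) F H2 n) <= Num.sqrt B * rnorm (\sum_(0 <= n < N) F H1 n).
    rewrite -(@ler_pXn2r _ 2) ?nnegrE ?mulr_ge0 ?sqrtr_ge0 ?rnorm_ge0// exprMn sqr_sqrtr//.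
    rewrite (orthogonal_sum (@rk_normE _ _ _ H2))//; last exact: Forth.
    rewrite (orthogonal_sum (@rk_normE _ _ _ H1))//; last exact: Forth.
    by rewrite mulr_sumr; apply: ler_sum => n _; exact: F12.
  have c2 := norm_cvg_rnorm (Fsum H2 sub).
  have c1 := norm_cvg_rnorm (Fsum H1 (fun x => id)).
  have c1' : (fun N => Num.sqrt B * rnorm (\sum_(0 <= n < N) F H1 n)) @ \oo -->
      Num.sqrt B * rnorm (\sum_(p <- s) p.1 *: kvec H1 (sval p.2)).
    by apply: cvgM c1; exact: cvg_cst.
  by apply: ler_cvg_to c2 c1' _; apply: nearW; exact: part.
by exists T; split=> // x Xx; rewrite Tk// rmorph1 scale1r.
Qed.

(** The kernel vectors span a dense subspace. *)
Lemma bounded_fixing_kernels (H : weighted_hardy R d) (T : {linear H -> H}) (C : R) :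
  0 <= C -> (forall f, rnorm (T f) <= C * rnorm f) ->
  (forall x, dom H x -> T (kvec H x) = kvec H x) -> forall f, T f = f.
Proof.
move=> C0 TC Tk f; apply/eqP; rewrite -subr_eq0; apply/eqP/rnorm_eq0/eqP.
rewrite eq_le rnorm_ge0 andbT; apply/ler_addgt0Pr => eps eps0; rewrite add0r.
have C1 : 0 < C + 1 by rewrite ltr_wpDl.
have e1 : 0 < eps / (C + 1) by rewrite divr_gt0.
have [||g hg|g Tg fg] := @dense_of_total R H (rk_dot H) (@rk_normE _ _ _ H)
  (fun g => T g = g) _ _ _ f _ e1.
- exact: linear0.
- by move=> c g h gT hT; rewrite linearP gT hT.
- by apply: kvec_total => x Xx; apply: hg; exact: Tk.
have -> : T f - f = T (f - g) - (f - g).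
  by rewrite linearB Tg opprB addrA subrK.
apply: le_trans (rnormB _ _) _.
apply: (@le_trans _ _ ((C + 1) * rnorm (f - g))).
  by rewrite mulrDl mul1r lerD2r.
by rewrite mulrC -ler_pdivlMr.
Qed.

End Inclusion.

(** * Operator norms *)

Section OperatorNorm.
Variables (R : realType) (V W : completeNormedModType R[i]).

Lemma rnorm_le1 (f : V) : (`|f| <= 1) = (rnorm f <= 1).
Proof. by rewrite rnormE -lecR. Qed.

Lemma opnorm_ub (T : V -> W) (C : R) : 0 <= C -> (forall f, rnorm (T f) <= C * rnorm f) ->
  (opnorm T <= C%:E)%E.
Proof.
move=> C0 TC; apply: ge_ereal_sup => _ [f /= f1 <-]; rewrite lee_fin.
rewrite rnorm_le1 in f1; apply: le_trans (TC f) _.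
by rewrite ler_piMr.
Qed.

Lemma opnorm_bound (T : {linear V -> W}) (C : R) : opnorm T = C%:E ->
  forall f, rnorm (T f) <= C * rnorm f.
Proof.
move=> TC f; have [f0|f0] := eqVneq (rnorm f) 0.
  by rewrite f0 mulr0 (rnorm_eq0 f0) linear0 rnorm0.
have fp : 0 < rnorm f by rewrite lt_neqAle eq_sym f0 rnorm_ge0.
have : ((rnorm (T (((rnorm f)^-1%:C)%C *: f)))%:E <= opnorm T)%E.
  apply: ereal_sup_ubound; exists (((rnorm f)^-1%:C)%C *: f) => //=.
  by rewrite rnorm_le1 rnormZ rnorm_real gtr0_norm ?invr_gt0// mulVf.
rewrite TC lee_fin linearZ rnormZ rnorm_real gtr0_norm ?invr_gt0//.
by rewrite mulrC ler_pdivrMr.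
Qed.

Lemma opnorm_gt0 (T : V -> W) (f : V) : rnorm f <= 1 -> T f != 0 -> (0 < opnorm T)%E.
Proof.
move=> f1 Tf; apply: (@lt_le_trans _ _ (rnorm (T f))%:E).
  rewrite lte_fin lt_neqAle eq_sym rnorm_ge0 andbT.
  by apply: contra_neq Tf => /rnorm_eq0.
by apply: ereal_sup_ubound; exists f => //=; rewrite rnorm_le1.
Qed.

End OperatorNorm.

(** * Bounds on the distortion *)

Section Distortion.
Variables (R : realType) (d : nat).
Local Notation conj := Num.conj.
Local Notation dom H := (natural_domain d (wh_coef H)).

(** The inverse operator sends kernel vectors to kernel vectors, with inverse
weights. *)
Lemma rkhs_iso_kernel_iso (H1 H2 : weighted_hardy R d) (T : {linear H1 -> H2})
    (Tinv : H2 -> H1) (C C' : R) :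
  rkhs_iso T -> cancel T Tinv -> cancel Tinv T ->
  0 <= C -> (forall f, rnorm (T f) <= C * rnorm f) ->
  0 <= C' -> (forall f, rnorm (Tinv f) <= C' * rnorm f) ->
  exists lam phi lam' phi', kernel_iso H1 H2 C C' lam phi lam' phi'.
Proof.
move=> [_ _ [lam [phi [lam0 [XX inj surj] Tk]]]] TK KT C0 TC C'0 TC'.
have preimage y : exists x, dom H2 y -> dom H1 x /\ phi x = y.
  have [Xy|nXy] := pselect (dom H2 y); last by exists 0.
  by have [x Xx <-] := surj y Xy; exists x.
have [psi psiP'] := choice preimage.
have psiP y : dom H2 y -> dom H1 (psi y) /\ phi (psi y) = y := psiP' y.
have psiK x : dom H1 x -> psi (phi x) = x.
  move=> Xx; have X2 : dom H2 (phi x) by exact: XX.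
  by have [X1 e] := psiP _ X2; apply: inj; rewrite ?in_setE.
pose TL := GRing.isLinear.Build _ _ _ _ Tinv (can2_linear TK KT).
pose Ti : {linear H2 -> H1} := HB.pack_for {linear H2 -> H1} Tinv TL.
exists lam, phi, (fun y => (lam (psi y))^-1), psi; split.
- split=> //.
  by exists T; split.
- split=> //; first by move=> y /psiP[].
  exists Ti; split=> // y Xy; have [X1 e] := psiP _ Xy.
  have cl : conj (lam (psi y)) != 0 by rewrite fmorph_eq0; exact: lam0.
  apply: (can_inj TK); rewrite [T (Ti _)]KT linearZ /= Tk// e scalerA fmorphV.
  by rewrite mulVf ?scale1r.
- move=> x Xx; rewrite psiK//; split=> //.
  by rewrite divff//; exact: lam0.
- move=> y Xy; have [X1 e] := psiP _ Xy; rewrite e; split=> //.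
  by rewrite mulVf//; exact: lam0.
Qed.

(** If the inverse is unbounded then the product of the norms is infinite, as
[opnorm T] is positive; otherwise [kernel_iso_coefs] applies. *)
Lemma distortion_bound (H1 H2 : weighted_hardy R d) (r : R)
    (T : {linear H1 -> H2}) (Tinv : H2 -> H1) :
  (0 < d)%N -> 0 < r -> has_radius H1 r -> has_radius H2 r ->
  rkhs_iso T -> cancel T Tinv -> cancel Tinv T ->
  (opnorm T * opnorm Tinv = +oo)%E \/
  exists delta : R, [/\ 0 < delta, (opnorm T * opnorm Tinv = delta%:E)%E &
    forall n k, wh_coef H2 n * wh_coef H1 k <=
      delta ^+ 6 * (wh_coef H1 n * wh_coef H2 k)].
Proof.
move=> d0 r0 r1 r2 Tiso TK KT.
pose TL := GRing.isLinear.Build _ _ _ _ Tinv (can2_linear TK KT).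
pose Ti : {linear H2 -> H1} := HB.pack_for {linear H2 -> H1} Tinv TL.
have nk (H : weighted_hardy R d) : rnorm (kvec H 0) = 1 by rewrite kvec0 rnorm_kpart0.
have k0 (H : weighted_hardy R d) : kvec H 0 != 0.
  by apply: contra_eq_neq (nk H) => ->; rewrite rnorm0 eq_sym oner_eq0.
have T0 : (0 < opnorm T)%E.
  apply: (@opnorm_gt0 _ _ _ _ (kvec H1 0)); first by rewrite nk.
  by apply: contra_neq (k0 H1) => h; apply: (can_inj TK); rewrite h linear0.
have Ti0 : (0 < opnorm Tinv)%E.
  apply: (@opnorm_gt0 _ _ _ _ (kvec H2 0)); first by rewrite nk.
  by apply: contra_neq (k0 H2) => h; apply: (can_inj KT); rewrite h -[LHS](linear0 Ti).
case E : (opnorm T) T0 => [C||] // T0; last by left; rewrite gt0_mulye.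
case E' : (opnorm Tinv) Ti0 => [C'||] // Ti0; last by left; rewrite gt0_muley.
rewrite !lte_fin in T0 Ti0; right; exists (C * C'); split => //.
  exact: mulr_gt0.
have [lam [phi [lam' [phi' iso]]]] := rkhs_iso_kernel_iso Tiso TK KT (ltW T0)
  (opnorm_bound E) (ltW Ti0) (opnorm_bound (T := Ti) E').
exact: (kernel_iso_coefs d0 r0 r1 r2 iso).
Qed.

Lemma inclusion_distortion (H1 H2 : weighted_hardy R d) (r A B : R) :
  has_radius H1 r -> has_radius H2 r -> 0 <= A -> 0 <= B ->
  (forall n, wh_coef H2 n <= A * wh_coef H1 n) ->
  (forall n, wh_coef H1 n <= B * wh_coef H2 n) ->
  (delta_RK H1 H2 <= (Num.sqrt (A * B))%:E)%E.
Proof.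
move=> r1 r2 A0 B0 ba ab.
have sub12 := dom_sub r1 r2 ba; have sub21 := dom_sub r2 r1 ab.
have [_ _ [T [TC Tk]]] := inclusion_kernel_map A0 ba sub12.
have [_ _ [T' [TC' Tk']]] := inclusion_kernel_map B0 ab sub21.
have sA := sqrtr_ge0 A; have sB := sqrtr_ge0 B.
have Tk1 x : dom H1 x -> T (kvec H1 x) = kvec H2 x.
  by move=> Xx; rewrite Tk// rmorph1 scale1r.
have Tk1' x : dom H2 x -> T' (kvec H2 x) = kvec H1 x.
  by move=> Xx; rewrite Tk'// rmorph1 scale1r.
have K1 : cancel T T'.
  apply: (@bounded_fixing_kernels _ _ H1 (T' \o T)%FUN (Num.sqrt B * Num.sqrt A)).
  - exact: mulr_ge0.
  - by move=> f /=; apply: le_trans (TC' _) _; rewrite -mulrA ler_wpM2l.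
  - by move=> x Xx /=; rewrite Tk1// (Tk1' _ (sub12 _ Xx)).
have K2 : cancel T' T.
  apply: (@bounded_fixing_kernels _ _ H2 (T \o T')%FUN (Num.sqrt A * Num.sqrt B)).
  - exact: mulr_ge0.
  - by move=> f /=; apply: le_trans (TC _) _; rewrite -mulrA ler_wpM2l.
  - by move=> x Xx /=; rewrite Tk1'// (Tk1 _ (sub21 _ Xx)).
apply: (@le_trans _ _ (opnorm T * opnorm T')%E).
  apply: ereal_inf_lbound; exists T, T'; split=> //; split.
  - by exists T'.
  - by exists (Num.sqrt A) => f; rewrite !rnormE -rmorphM lecR.
  exists (fun=> 1), id; split.
  - by move=> x _; exact: oner_neq0.
  - split=> [x Xx||x Xx]; [exact: sub12|by []|by exists x => //; exact: sub21].
  - by move=> x Xx; rewrite Tk.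
have nn (V W : completeNormedModType R[i]) (U : {linear V -> W}) : (0 <= opnorm U)%E.
  apply: (@le_trans _ _ (rnorm (U 0))%:E); first by rewrite lee_fin rnorm_ge0.
  by apply: ereal_sup_ubound; exists 0 => //=; rewrite rnorm_le1 rnorm0.
rewrite sqrtrM// EFinM; apply: lee_pmul; rewrite ?nn//; exact: opnorm_ub.
Qed.

End Distortion.

Local Open Scope ereal_scope.

Theorem theorem8p8 (R : realType) (d : nat) (r : R)
    (H H1 H2 : weighted_hardy R d) :
  (0 < d)%N -> (0 < r)%R -> has_radius H r ->
  iso_class H r H1 -> iso_class H r H2 ->
  let a := wh_coef H1 in
  let b := wh_coef H2 in
  let sup_ba := ereal_sup (range (fun n => ((b n / a n)%R)%:E)) in
  let sup_ab := ereal_sup (range (fun n => ((a n / b n)%R)%:E)) in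
  let M := maxe sup_ba sup_ab in
  let m := mine sup_ba sup_ab in
  maxe ((6^-1)%R%:E * lne M) ((3^-1)%R%:E * lne m) <= rho_RK H1 H2 /\
  rho_RK H1 H2 <= (2^-1)%R%:E * lne (M * m).
Proof.
move=> d0 r0 _ [r1 _] [r2 _] a b sup_ba sup_ab M m.
have a0 n : (0 < a n)%R by exact: wh_coef_gt0.
have b0 n : (0 < b n)%R by exact: wh_coef_gt0.
have ba1 : 1 <= sup_ba.
  by apply: ereal_sup_ubound; exists 0%N => //; rewrite /a /b !wh_coef0 divr1.
have ab1 : 1 <= sup_ab.
  by apply: ereal_sup_ubound; exists 0%N => //; rewrite /a /b !wh_coef0 divr1.
have delta0 : 0 <= delta_RK H1 H2.
  apply: le_ereal_inf_tmp => _ [T [Tinv [iso TK KT ->]]].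
  have [->|[delta [dl -> _]]] := distortion_bound d0 r0 r1 r2 iso TK KT.
    exact: leey.
  by rewrite lee_fin ltW.
split; last first.
  rewrite /rho_RK.
  have [E|[A [B [EA EB]]]] : M * m = +oo \/ exists A B, sup_ba = A%:E /\ sup_ab = B%:E.
    have M1 : 1 <= M by rewrite le_max ba1.
    have m1 : 1 <= m by rewrite le_min ba1 ab1.
    case EA : sup_ba ba1 => [A||] // _; last first.
      by left; rewrite /M EA maxye gt0_mulye// (lt_le_trans _ m1).
    case EB : sup_ab ab1 => [B||] // _; last first.
      by left; rewrite /M EB maxey gt0_mulye// (lt_le_trans _ m1).
    by right; exists A, B.
  - by rewrite E /= gt0_muley ?leey// lte_fin invr_gt0.
  have A1 : (1 <= A)%R by rewrite -lee_fin -EA.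
  have B1 : (1 <= B)%R by rewrite -lee_fin -EB.
  have A0 : (0 < A)%R by exact: lt_le_trans A1.
  have B0 : (0 < B)%R by exact: lt_le_trans B1.
  have Mm : M * m = (A * B)%:E.
    rewrite /M /m EA EB; case: (leP A B) => [AB|/ltW BA].
      by rewrite max_r ?min_l ?lee_fin// -EFinM mulrC.
    by rewrite max_l ?min_r ?lee_fin// -EFinM.
  have hba n : (b n <= A * a n)%R.
    rewrite -ler_pdivrMr// -lee_fin -EA; apply: ereal_sup_ubound; by exists n.
  have hab n : (a n <= B * b n)%R.
    rewrite -ler_pdivrMr// -lee_fin -EB; apply: ereal_sup_ubound; by exists n.
  have AB0 : (0 < A * B)%R by exact: mulr_gt0.
  have h := inclusion_distortion r1 r2 (ltW A0) (ltW B0) hba hab.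
  have sAB : (0 < Num.sqrt (A * B))%R by rewrite sqrtr_gt0.
  apply: (@le_trans _ _ (lne (Num.sqrt (A * B))%:E)).
    by rewrite lee_lne// in_itv /= ?delta0 ?leey// lee_fin ltW.
  rewrite Mm !lne_EFin// -EFinM lee_fin.
  rewrite -{2}(sqr_sqrtr (ltW AB0)) lnXn// mulrnAr -mulrnAl -[(_ *+ 2)%R]mulr_natr mulVf ?pnatr_eq0//.
  by rewrite mul1r.
set K := maxe _ _.
have main x : (exists (T : {linear H1 -> H2}) (Tinv : H2 -> H1),
    [/\ rkhs_iso T, cancel T Tinv, cancel Tinv T & x = opnorm T * opnorm Tinv]) ->
    expeR K <= x.
  move=> [T [Tinv [iso TK KT ->]]].
  have [->|[delta [dl -> hd]]] := distortion_bound d0 r0 r1 r2 iso TK KT.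
    exact: leey.
  have d6 n k : (b n / a n * (a k / b k) <= delta ^+ 6)%R.
    rewrite mulf_div ler_pdivrMr ?mulr_gt0//; exact: hd.
  (* One of the two quotients in [d6] is 1 at index 0. *)
  have M6 : M <= (delta ^+ 6)%:E.
    rewrite ge_max; apply/andP; split; apply: ge_ereal_sup => _ [n _ <-]; rewrite lee_fin.
      by have := d6 n 0%N; rewrite /a /b !wh_coef0 divr1 mulr1.
    by have := d6 0%N n; rewrite /a /b !wh_coef0 divr1 mul1r.
  (* Otherwise some [b n / a n] and some [a k / b k] would both exceed [delta^3]. *)
  have m3 : m <= (delta ^+ 3)%:E.
    rewrite leNgt lt_min; apply/negP => /andP[].
    move=> /ereal_sup_gt[_ [n _ <-]] hn /ereal_sup_gt[_ [k _ <-]] hk.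
    rewrite !lte_fin in hn hk; have := d6 n k; rewrite leNgt => /negP; apply.
    have d3 : (0 <= delta ^+ 3)%R by rewrite exprn_ge0// ltW.
    by rewrite (exprD _ 3 3); exact: ltr_pM.
  have M1 : 1 <= M by rewrite le_max ba1.
  have m1 : 1 <= m by rewrite le_min ba1 ab1.
  have step (y : \bar R) n : (0 < n)%N -> 1 <= y -> y <= (delta ^+ n)%:E ->
      (n%:R^-1)%R%:E * lne y <= lne delta%:E.
    move=> n0 y1 yn; have yp : 0 <= y by exact: le_trans y1.
    have : lne y <= lne (delta ^+ n)%:E.
      by rewrite lee_lne// in_itv /= ?yp ?leey// lee_fin exprn_ge0// ltW.
    rewrite !lne_EFin ?exprn_gt0// lnXn//.
    have n1 : (0 < n%:R^-1 :> R)%R by rewrite invr_gt0 ltr0n.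
    move=> h; have := lee_wpmul2l (ltW n1 : 0 <= (n%:R^-1)%R%:E) h.
    by rewrite -EFinM -[(ln _ *+ n)%R]mulr_natl mulrA mulVf ?mul1r// pnatr_eq0 -lt0n.
  have Kd : K <= lne delta%:E.
    by rewrite /K ge_max; apply/andP; split; exact: step.
  rewrite -(@lneK R delta%:E) ?lee_expeR//.
  by rewrite in_itv /= lee_fin ltW//= leey.
have : expeR K <= delta_RK H1 H2 by apply: le_ereal_inf_tmp => x /main.
move=> h; rewrite /rho_RK -(expeRK K) lee_lne// in_itv /= ?expeR_ge0 ?delta0 ?leey//.
Qed.
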